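(* Let $\mu\in\mathcal C$ be a nonzero nilpotent bracket and let $\tilde\mu(t)$ solve the normalised bracket flow $$\tfrac{d}{dt}\tilde\mu=-\pi\big(P_{\tilde\mu}-\alpha_{\tilde\mu}\mathrm{Id}\big)\tilde\mu,\qquad\tilde\mu(0)=\mu/\|\mu\|,\qquad \alpha_{\tilde\mu}:=-\langle\pi(P_{\tilde\mu})\tilde\mu,\tilde\mu\rangle .$$ Then there is an increasing sequence of times $t_l\to\infty$ such that $\tilde\mu(t_l)$ converges, as $l\to\infty$, to a nonzero fixed point of this normalised flow.
   Context: Let $\mathfrak g$ be a real vector space of dimension $2n$ with complex structure $J$ and inner product $\langle\cdot,\cdot\rangle$ for which $J$ is orthogonal; $e_1,\dots,e_{2n}$ an orthonormal basis. A bracket is a skew-symmetric bilinear map $\nu:\mathfrak g\times\mathfrak g\to\mathfrak g$, identified with a linear map $\Lambda^2\mathfrak g\to\mathfrak g$; $\Lambda^2\mathfrak g$ carries the inner product $\langle v_1\wedge v_2,w_1\wedge w_2\rangle=\det(\langle v_i,w_j\rangle)$; brackets carry the inner product $\langle\nu,\eta\rangle=\sum_{i<j}\langle\nu(e_i,e_j),\eta(e_i,e_j)\rangle$ and norm $\|\cdot\|$. $\mathcal C$ is the set of brackets satisfying the Jacobi identity and $\nu(J\cdot,\cdot)=J\nu(\cdot,\cdot)$. For $A\in\mathrm{End}(\mathfrak g)$, $\pi(A)\nu=A\nu(\cdot,\cdot)-\nu(A\cdot,\cdot)-\nu(\cdot,A\cdot)$. $P_\nu:=\nu\nu^*$, i.e.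 $P_\nu v=\sum_{i<j}\langle v,\nu(e_i,e_j)\rangle\nu(e_i,e_j)$. *)

(* Defs.v *)
From HB Require Import structures.
From mathcomp Require Import all_boot all_order all_algebra.
From mathcomp Require Import all_classical all_reals all_analysis.
Set Implicit Arguments. Unset Strict Implicit. Unset Printing Implicit Defensive.
Import Order.TTheory GRing.Theory Num.Theory.
Local Open Scope ring_scope.

(* g = R^N (N = 2n) with the orthonormal basis e_0..e_{N-1}; vectors are
   coordinate functions, endomorphisms are matrices acting on coordinates:
   (A x)_k = \sum_l A k l * x l, so A e_i = \sum_l A l i e_l. *)
Definition vec (R : realType) (N : nat) := 'I_N -> R.

(* A bracket nu is given by its structure constants:
   c i j k = < nu(e_i, e_j), e_k >. *)
Definition bracket (R : realType) (N : nat) := 'I_N -> 'I_N -> 'I_N -> R.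

Definition bzero (R : realType) (N : nat) : bracket R N := fun _ _ _ => 0.

Definition bscale (R : realType) (N : nat) (r : R) (c : bracket R N) : bracket R N :=
  fun i j k => r * c i j k.

Definition brapp (R : realType) (N : nat) (c : bracket R N) (x y : vec R N) : vec R N :=
  fun k => \sum_(i < N) \sum_(j < N) x i * y j * c i j k.

Definition mxapp (R : realType) (N : nat) (A : 'M[R]_N) (x : vec R N) : vec R N :=
  fun k => \sum_(l < N) A k l * x l.

Definition skew (R : realType) (N : nat) (c : bracket R N) :=
  forall i j k, c i j k = - c j i k.

Definition jacobi (R : realType) (N : nat) (c : bracket R N) :=
  forall x y z : vec R N, forall k,
    brapp c (brapp c x y) z k + brapp c (brapp c y z) x k
    + brapp c (brapp c z x) y k = 0.

Definition J_compat (R : realType) (N : nat) (J : 'M[R]_N) (c : bracket R N) :=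
  forall x y : vec R N, forall k, brapp c (mxapp J x) y k = mxapp J (brapp c x y) k.

Definition in_C (R : realType) (N : nat) (J : 'M[R]_N) (c : bracket R N) :=
  [/\ skew c, jacobi c & J_compat J c].

(* right-normed iterated brackets [x_m, [x_{m-1}, ... [x_1, x_0]]];
   these span the m-th term of the lower central series *)
Fixpoint lcs (R : realType) (N : nat) (c : bracket R N) (x : nat -> vec R N) (m : nat)
  : vec R N :=
  match m with
  | 0 => x 0%N
  | m'.+1 => brapp c (x m) (lcs c x m')
  end.

Definition nilpotent (R : realType) (N : nat) (c : bracket R N) :=
  exists m : nat, forall (x : nat -> vec R N) k, lcs c x m k = 0.

(* pi(A) nu = A nu(.,.) - nu(A.,.) - nu(., A.) *)
Definition pi_act (R : realType) (N : nat) (A : 'M[R]_N) (c : bracket R N) : bracket R N :=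
  fun i j k => \sum_(l < N) A k l * c i j l - \sum_(l < N) A l i * c l j k
               - \sum_(l < N) A l j * c i l k.

Definition bdot (R : realType) (N : nat) (c d : bracket R N) : R :=
  \sum_(i < N) \sum_(j < N | (i < j)%N) \sum_(k < N) c i j k * d i j k.

Definition bnorm (R : realType) (N : nat) (c : bracket R N) : R := Num.sqrt (bdot c c).

(* P_nu v = sum_{i<j} <v, nu(e_i,e_j)> nu(e_i,e_j) *)
Definition Pmx (R : realType) (N : nat) (c : bracket R N) : 'M[R]_N :=
  \matrix_(a < N, b < N) \sum_(i < N) \sum_(j < N | (i < j)%N) c i j a * c i j b.

Definition alpha (R : realType) (N : nat) (c : bracket R N) : R :=
  - bdot (pi_act (Pmx c) c) c.

Definition flow_rhs (R : realType) (N : nat) (c : bracket R N) : bracket R N :=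
  fun i j k => - pi_act (Pmx c - (alpha c)%:M) c i j k.

(* Main.v *)
(* Let m(t) be the normalised flow, P = P_m, and let g solve g' = g P with inverse h.
   Then g m(h _, h _) = q(t) c for a scalar q > 0, where c are the structure constants
   of mu in the basis given by g(0). With the new time s' = q^2 the Gram matrix G = g g^T
   satisfies dG_kl/ds = tr (c_k G c_l^T G). In a basis adapted to the lower central
   series, with weights w, this system is triangular, so G_kl is a polynomial in s of
   degree less than min (w_k, w_l), and s tends to infinity with t. Rescaling the k-th
   basis vector by s^((1 - w_k) / 2) makes G converge to a block diagonal matrix L, which
   is positive definite because the first layer generates, and makes c converge to the
   associated graded bracket. On the graded bracket the limit of P acts, up to a factor,
   as (w_k - 1) / 2 on the layer of weight w_k; hence pi(P) nu is proportional to nu for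
   every limit point nu of m, and nu is a fixed point. *)
Require Import Defs.
From HB Require Import structures.
From mathcomp Require Import all_boot all_order all_algebra.
From mathcomp Require Import all_classical all_reals all_analysis.
From mathcomp Require Import ring lra.
Import Order.TTheory GRing.Theory Num.Theory.
Import numFieldNormedType.Exports.
Local Open Scope ring_scope.
Local Open Scope classical_set_scope.

Set Implicit Arguments.
Unset Strict Implicit.
Unset Printing Implicit Defensive.

(** The frame equation g' = g P is chosen so that the derivative of the push-forward loses its whole
    pi(P) part: the transported bracket moves along its own ray, by q = exp(- int alpha) / |mu|.
    Since P is quadratic in m, the entries of g P g^T are (q^2 / 2) tr(c_k G c_l^T G); the system
    closes in G alone, and the clock s' = q^2 removes the one unknown scalar. The exponent (1 - w_k)
    / 2 is dictated by degrees: G_kl has degree below min(w_k, w_l), so after rescaling only entries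
    with w_k = w_l survive, through their coefficient of degree w_k - 1. Comparing these
    coefficients in s dG/ds gives tr(c_k L c_l^T L) = (w_k - 1) L_kl for the graded c. This one
    identity feeds both the definiteness of L and the eigenvalues of the limit of P. The obstacle is
    that G fixes the frame only up to an orthogonal factor, which nothing controls. Rescaled Gram
    matrices converge, but the rescaled frame and m do so only along a subsequence. *)

(** * Linear differential equations on the half-line *)

(* Continuity is two-sided also at 0: functions given on [0, +oo[ only are first
   composed with [Num.max _ 0]. *)
Definition hcont (R : realType) (f : R -> R) :=
  forall t : R, 0 <= t -> {for t, continuous f}.

(** The derivative is asked at positive times only, as in the hypotheses on the flow; continuity up
    to 0 lets the mean value theorem reach the initial value. *)
Definition hderive (R : realType) (f df : R -> R) :=
  hcont f /\ forall t : R, 0 < t -> is_derive t 1 f (df t).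

Lemma hcont_cst (R : realType) (a : R) : hcont (fun=> a).
Proof. by move=> t _; apply: cst_continuous. Qed.

Lemma hcontD (R : realType) (f g : R -> R) :
  hcont f -> hcont g -> hcont (fun t => f t + g t).
Proof. by move=> hf hg t t0; apply: continuousD; [apply: hf|apply: hg]. Qed.

Lemma hcontN (R : realType) (f : R -> R) : hcont f -> hcont (fun t => - f t).
Proof. by move=> hf t t0; apply: continuousN; apply: hf. Qed.

Lemma hcontM (R : realType) (f g : R -> R) :
  hcont f -> hcont g -> hcont (fun t => f t * g t).
Proof. by move=> hf hg t t0; apply: continuousM; [apply: hf|apply: hg]. Qed.

Lemma hcont_sum (R : realType) (I : Type) (r : seq I) (P : pred I)
    (f : I -> R -> R) :
  (forall i, P i -> hcont (f i)) -> hcont (fun t => \sum_(i <- r | P i) f i t).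
Proof.
move=> hf; elim: r => [|i r ih].
  rewrite [X in hcont X](_ : _ = fun=> 0); first exact: hcont_cst.
  by apply/funext => t; rewrite big_nil.
rewrite [X in hcont X](_ : _ = fun t =>
    if P i then f i t + \sum_(j <- r | P j) f j t
    else \sum_(j <- r | P j) f j t); last by apply/funext => t; rewrite big_cons.
by move: (hf i); case: (P i) => // hfi; apply: hcontD => //; apply: hfi.
Qed.

Lemma hderive_cst (R : realType) (a : R) : hderive (fun=> a) (fun=> 0).
Proof. by split=> [|t _]; [apply: hcont_cst|apply: is_derive_cst]. Qed.

Lemma hderive_eq (R : realType) (f df dg : R -> R) :
  hderive f df -> (forall t : R, 0 < t -> df t = dg t) -> hderive f dg.
Proof. by move=> [cf hf] e; split=> // t t0; rewrite -e//; apply: hf. Qed.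

Lemma hderiveD (R : realType) (f g df dg : R -> R) :
  hderive f df -> hderive g dg ->
  hderive (fun t => f t + g t) (fun t => df t + dg t).
Proof.
move=> [cf hf] [cg hg]; split=> [|t t0]; first exact: hcontD.
by apply: is_deriveD; [apply: hf|apply: hg].
Qed.

Lemma hderiveN (R : realType) (f df : R -> R) :
  hderive f df -> hderive (fun t => - f t) (fun t => - df t).
Proof.
move=> [cf hf]; split=> [|t t0]; first exact: hcontN.
by apply: is_deriveN; apply: hf.
Qed.

Lemma hderiveM (R : realType) (f g df dg : R -> R) :
  hderive f df -> hderive g dg ->
  hderive (fun t => f t * g t) (fun t => df t * g t + f t * dg t).
Proof.
move=> [cf hf] [cg hg]; split=> [|t t0]; first exact: hcontM.
rewrite addrC [df t * _]mulrC.
by apply: (@is_deriveM _ _ f g); [apply: hf|apply: hg].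
Qed.

Lemma hderive_sum (R : realType) (I : Type) (r : seq I) (P : pred I)
    (f df : I -> R -> R) :
  (forall i, P i -> hderive (f i) (df i)) ->
  hderive (fun t => \sum_(i <- r | P i) f i t)
            (fun t => \sum_(i <- r | P i) df i t).
Proof.
move=> hf; elim: r => [|i r ih].
  rewrite [X in hderive X](_ : _ = fun=> 0); last first.
    by apply/funext => t; rewrite big_nil.
  by apply: hderive_eq (hderive_cst 0) _ => t _; rewrite big_nil.
have E (h : I -> R -> R) : (fun t => \sum_(j <- i :: r | P j) h j t) = (fun t =>
    if P i then h i t + \sum_(j <- r | P j) h j t
    else \sum_(j <- r | P j) h j t) by apply/funext => t; rewrite big_cons.
by rewrite !E; move: (hf i); case: (P i) => // hfi; apply: hderiveD => //; apply: hfi.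
Qed.

Lemma hderive_comp (R : realType) (u du f df : R -> R) :
  (forall x : R, is_derive x 1 u (du x)) -> hderive f df ->
  hderive (fun t => u (f t)) (fun t => du (f t) * df t).
Proof.
move=> hu [cf hf]; split=> t t0.
  apply: (@continuous_comp _ _ _ f u); first exact: cf.
  apply: differentiable_continuous; apply/derivable1_diffP.
  exact: (@ex_derive _ _ _ _ _ _ _ (hu (f t))).
have hft := hf t t0; have huf := hu (f t).
exact: (@is_derive1_comp _ u f).
Qed.

Lemma hderive_mono (R : realType) (f df : R -> R) (a b : R) : hderive f df ->
  0 <= a -> a <= b -> (forall t, a < t -> t < b -> 0 <= df t) -> f a <= f b.
Proof.
move=> [cf hf] a0 ab h; move: ab; rewrite le_eqVlt => /predU1P[->//|ab].
have [|c|c cab] := @MVT R f df a b ab.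
- by move=> x /[!in_itv]/= /andP[ax _]; apply: hf; apply: le_lt_trans ax.
- apply: continuous_in_subspaceT => x; rewrite inE/= in_itv/= => /andP[ax _].
  by apply: cf; apply: le_trans ax.
move: cab; rewrite in_itv/= => /andP[ac cb] e.
by rewrite -subr_ge0 e mulr_ge0 ?h// subr_ge0 ltW.
Qed.

(** Both [g + f] and [g - f] have nonnegative derivative. This stands in for estimates of integrals
    throughout [linear_ode]. *)
Lemma hderive_cmp (R : realType) (f df g dg : R -> R) (T : R) :
  hderive f df -> hderive g dg -> 0 <= T ->
  (forall t : R, 0 < t -> t < T -> `|df t| <= dg t) ->
  `|f T - f 0| <= g T - g 0.
Proof.
move=> hf hg T0 h; rewrite ler_norml; apply/andP; split.
  have := @hderive_mono R _ _ 0 T (hderiveD hg hf) (lexx 0) T0.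
  have H t : 0 < t -> t < T -> 0 <= dg t + df t.
    by move=> t0 tT; have := h _ t0 tT; rewrite ler_norml => /andP[]; lra.
  by move=> /(_ H); lra.
have := @hderive_mono R _ _ 0 T (hderiveD hg (hderiveN hf)) (lexx 0) T0.
have H t : 0 < t -> t < T -> 0 <= dg t - df t.
  by move=> t0 tT; have := h _ t0 tT; rewrite ler_norml => /andP[]; lra.
by move=> /(_ H); lra.
Qed.

Lemma hderive0 (R : realType) (f : R -> R) : hderive f (fun=> 0) ->
  forall t : R, 0 <= t -> f t = f 0.
Proof.
move=> hf t t0.
have := hderive_cmp hf (hderive_cst 0) t0.
rewrite subrr => h; apply/eqP; rewrite -subr_eq0 -normr_le0.
by apply: h => *; rewrite normr0.
Qed.

Lemma hcont_max (R : realType) (f : R -> R) :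
  hcont f -> continuous (fun t : R => f (Num.max t 0)).
Proof.
move=> cf t; apply: (@continuous_comp _ _ _ (fun t : R => Num.max t 0) f).
  apply: (@continuous_max _ _ id (fun=> 0)); first exact: cvg_id.
  exact: cvg_cst.
by apply: cf; rewrite le_max lexx orbT.
Qed.

(** The integral starts at -1 because the fundamental theorem of calculus is applied strictly to the
    right of the lower end and the derivative at 0 is wanted too. The clamp gives a continuous
    integrand left of 0; the subtracted integral restores the value 0 at time 0. *)
Definition prim (R : realType) (f : R -> R) (x : R) : R :=
  (\int[lebesgue_measure]_(t in `[(- 1), x]) f (Num.max t 0))%R
  - (\int[lebesgue_measure]_(t in `[(- 1), 0]) f (Num.max t 0))%R.

Lemma prim0 (R : realType) (f : R -> R) : prim f 0 = 0.
Proof. by rewrite /prim subrr. Qed.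

Lemma hderive_prim (R : realType) (f : R -> R) :
  hcont f -> hderive (prim f) f.
Proof.
move=> cf.
have cg := hcont_max cf.
have H (x : R) : 0 <= x -> is_derive x 1 (prim f) (f x).
  move=> x0.
  have [||||d e] := @continuous_FTC1_closed R (fun t : R => f (Num.max t 0)) (-1) x (x + 1).
  - by rewrite ltrDl.
  - apply: continuous_compact_integrable; first exact: segment_compact.
    exact: continuous_subspaceT.
  - by apply: lt_le_trans x0; rewrite ltrN10.
  - exact: cg.
  rewrite -[f x]subr0; apply: is_deriveB; first last.
  apply: DeriveDef => //.
  by rewrite -derive1E e max_l.
split=> t t0; last exact/H/ltW.
apply: differentiable_continuous; apply/derivable1_diffP.
exact: (@ex_derive _ _ _ _ _ _ _ (H t t0)).
Qed.

Lemma cvgr_norm_le (R : realType) (u : nat -> R) (a b c : R) :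
  (u n @[n --> \oo] --> a) -> (forall n, `|u n - b| <= c) -> `|a - b| <= c.
Proof.
move=> ua h.
have ub : (`|u n - b| @[n --> \oo] --> `|a - b|).
  by apply: cvg_norm; apply: cvgB => //; exact: cvg_cst.
rewrite -(cvg_lim _ ub)//.
apply: limr_le; first by apply/cvg_ex; exists `|a - b|.
exact: nearW.
Qed.

(** The explicit tail bound is the point: it makes the convergence of the series in [linear_ode]
    locally uniform in time, whence continuity of the sum. *)
Lemma geometric_series_cvg (R : realType) (u : nat -> R) (b : R) : 0 <= b ->
  (forall n, `|u n| <= b * 2^-1 ^+ n) ->
  exists a : R, (series u n @[n --> \oo] --> a) /\
    forall n, `|a - series u n| <= b * 2^-1 ^+ n * 2.
Proof.
move=> b0 h.
have cu : cvgn (series u).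
  apply: normed_cvg; apply: (@series_le_cvg _ _ (geometric b (2^-1 : R))).
  - by move=> n; apply: normr_ge0.
  - by move=> n /=; rewrite mulr_ge0// exprn_ge0// invr_ge0.
  - exact: h.
  - by apply: is_cvg_geometric_series; rewrite ger0_norm ?invf_lt1 ?ltr1n ?invr_ge0.
exists (limn (series u)); split=> // n.
rewrite -normrN opprB.
apply: (@cvgr_norm_le _ (fun=> series u n)); first exact: cvg_cst.
move=> _; rewrite -normrN opprB.
(* The exact factor of the partial geometric sum is kept so that the induction on [m] closes. *)
have H m : `|series u (n + m)%N - series u n| <= b * 2^-1 ^+ n * 2 * (1 - 2^-1 ^+ m).
  elim: m => [|m ih]; first by rewrite addn0 expr0 !subrr normr0 mulr0.
  rewrite addnS seriesEnat/= big_nat_recr//= -/(series u (n+m)).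
  have -> : \sum_(0 <= i < n + m) u i = series u (n + m)%N by rewrite seriesEnat.
  have -> : \sum_(0 <= i < n) u i = series u n by rewrite seriesEnat.
  rewrite addrAC; apply: le_trans (ler_normD _ _) _.
  apply: le_trans (lerD ih (h _)) _.
  by rewrite exprD exprS le_eqVlt; apply/orP; left; apply/eqP; field.
have cs : (series u (n + m)%N @[m --> \oo] --> limn (series u)).
  have -> : (fun m => series u (n + m)%N) = [sequence series u (m + n)%N]_m.
    by apply/funext => m; rewrite addnC.
  by rewrite cvg_shiftn.
apply: cvgr_norm_le cs _ => m; apply: le_trans (H m) _.
by rewrite ler_piMr ?mulr_ge0 ?exprn_ge0 ?invr_ge0// gerBl exprn_ge0 ?invr_ge0.
Qed.

Lemma mulmx_entry_le (R : realType) (m n p : nat) (A : 'M[R]_(m, n))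
    (X : 'M[R]_(n, p)) (K b : R) :
  0 <= K -> (forall i j, `|A i j| <= K) -> (forall i j, `|X i j| <= b) ->
  forall i j, `|(A *m X) i j| <= n%:R * K * b.
Proof.
move=> K0 hA hX i j; rewrite mxE; apply: le_trans (ler_norm_sum _ _ _) _.
apply: le_trans (_ : \sum_(k < n) K * b <= _).
  by apply: ler_sum => k _; rewrite normrM ler_pM.
by rewrite sumr_const card_ord -[leLHS]mulr_natl mulrA.
Qed.

Lemma matrix_bound (R : realType) (m n : nat) (X : 'M[R]_(m, n)) :
  exists2 b : R, 0 <= b & forall i j, `|X i j| <= b.
Proof.
exists (\sum_i \sum_j `|X i j|); first by do 2![apply: sumr_ge0 => ? _].
move=> i j; rewrite (bigD1 i)//= (bigD1 j)//= -addrA lerDl addr_ge0//.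
  exact: sumr_ge0.
by do 2![apply: sumr_ge0 => ? _].
Qed.

Lemma hderive_expR (R : realType) (c l : R) :
  hderive (fun t => c * expR (l * t)) (fun t => c * l * expR (l * t)).
Proof.
have hid : hderive (fun t : R => t) (fun=> 1).
  by split=> t _; [exact: cvg_id|exact: is_derive_id].
have hl := hderiveM (hderive_cst l) hid.
apply: hderive_eq (hderiveM (hderive_cst c)
  (@hderive_comp _ _ _ _ _ (@is_derive_expR R) hl)) _.
by move=> t _ /=; ring.
Qed.

(** These are not the successive approximations but their increments, the iterated integrals of the
    Peano-Baker series; the solution is their sum. *)
Fixpoint picard (R : realType) (m p : nat) (A : R -> 'M[R]_m) (X0 : 'M[R]_(m, p))
    (n : nat) : R -> 'M[R]_(m, p) :=
  if n is n'.+1 then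
    fun t => \matrix_(i, j) prim (fun s => (A s *m picard A X0 n' s) i j) t
  else fun=> X0.

Lemma hcont_mulmx (R : realType) (m n p : nat) (A : R -> 'M[R]_(m, n))
    (X : R -> 'M[R]_(n, p)) :
  (forall i j, hcont (fun t => A t i j)) -> (forall i j, hcont (fun t => X t i j)) ->
  forall i j, hcont (fun t => (A t *m X t) i j).
Proof.
move=> hA hX i j.
rewrite [X in hcont X](_ : _ = fun t => \sum_k A t i k * X t k j).
  by apply: hcont_sum => k _; apply: hcontM.
by apply/funext => t; rewrite mxE.
Qed.
Arguments hcont_mulmx {R m n p A X}.

(* The n-th term of the Peano-Baker series is bounded by [b 2^-n exp (l t)] with
   [l] twice the bound on the generator, so the series converges geometrically. *)
Lemma linear_ode (R : realType) (m p : nat) (A : R -> 'M[R]_m)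
    (X0 : 'M[R]_(m, p)) (K : R) :
  (forall i j, hcont (fun t => A t i j)) ->
  (forall t : R, 0 <= t -> forall i j, `|A t i j| <= K) ->
  exists X : R -> 'M[R]_(m, p), X 0 = X0 /\
    forall i j, hderive (fun t => X t i j) (fun t => (A t *m X t) i j).
Proof.
wlog K0 : K / 0 <= K => [W hA hK|hA hK].
  apply: (W `|K|) => // t t0 i j; apply: le_trans (hK t t0 i j) _.
  exact: ler_norm.
have [b b0 hb] := matrix_bound X0.
(* With this rate the derivative of [b 2^-(n+1) exp (l t)] is exactly the bound
   [m K b 2^-n exp (l t)] on the entries of [A E_n], so each integration gains a factor 1/2. *)
pose l := 2 * (m%:R * K); have l0 : 0 <= l by rewrite !mulr_ge0.
pose E := picard A X0.
have cE n : forall i j, hcont (fun t => E n t i j).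
  elim: n => [|n ih] i j; first exact: hcont_cst.
  rewrite [X in hcont X](_ : _ = prim (fun s => (A s *m E n s) i j)).
    by case: (hderive_prim (hcont_mulmx hA ih i j)).
  by apply/funext => t; rewrite mxE.
have dE n i j : hderive (fun t => E n.+1 t i j) (fun t => (A t *m E n t) i j).
  rewrite [X in hderive X](_ : _ = prim (fun s => (A s *m E n s) i j)).
    exact: (hderive_prim (hcont_mulmx hA (cE n) i j)).
  by apply/funext => t; rewrite mxE.
have bE n (t : R) : 0 <= t -> forall i j,
    `|E n t i j| <= b * expR (l * t) * 2^-1 ^+ n.
  elim: n t => [|n ih] t t0 i j.
    rewrite expr0 mulr1; apply: le_trans (hb i j) _.
    by rewrite ler_peMr// -expR0 ler_expR mulr_ge0.
  have := hderive_cmp (dE n i j) (hderive_expR (b * 2^-1 ^+ n.+1) l) t0.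
  have -> : E n.+1 0 i j = 0 by rewrite mxE prim0.
  rewrite subr0 => h; apply: le_trans (h _) _.
    move=> s s0 st; apply: le_trans (mulmx_entry_le K0 (hK s (ltW s0)) (ih s (ltW s0)) i j) _.
    by rewrite /l exprS le_eqVlt; apply/orP; left; apply/eqP; field.
  rewrite [b * expR _ * _]mulrAC gerBl mulr_ge0 ?expR_ge0//.
  by rewrite mulr_ge0 ?exprn_ge0 ?invr_ge0.
have lim_ex (t : R) i j : exists a, 0 <= t ->
    (series (fun n => E n t i j) n @[n --> \oo] --> a) /\
    forall n, `|a - series (fun n => E n t i j) n| <= b * expR (l * t) * 2^-1 ^+ n * 2.
  have [t0|_] := leP 0 t; last by exists 0.
  have [//|a h] := geometric_series_cvg _ (fun n => bE n t t0 i j).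
    by rewrite mulr_ge0// expR_ge0.
  by exists a.
pose Y (t : R) i j := sval (cid (lim_ex t i j)).
have hY (t : R) i j := svalP (cid (lim_ex t i j)).
pose S n (t : R) i j := series (fun k => E k t i j) n.
pose X (t : R) : 'M[R]_(m, p) := \matrix_(i, j) Y (Num.max t 0) i j.
have hX (t : R) i j n : 0 <= t -> `|X t i j - S n t i j| <= b * expR (l * t) * 2^-1 ^+ n * 2.
  by move=> t0; rewrite mxE max_l//; apply: (hY t i j t0).2.
have cS n i j : hcont (fun t => S n t i j).
  rewrite /S; under [X in hcont X]eq_fun do rewrite seriesEnat.
  by apply: hcont_sum => k _.
have geo (c : R) : (c * 2^-1 ^+ n @[n --> \oo] --> 0).
  by apply: cvg_geometric; rewrite ger0_norm ?invf_lt1 ?ltr1n ?invr_ge0.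
have cX i j : hcont (fun t => X t i j).
  move=> t t0; apply/cvgrPdist_le => e e0.
  (* The tail bound at time [t + 1] dominates the one at every earlier time, so a single partial sum
     serves a whole neighbourhood of [t]. *)
  pose c := b * expR (l * (t + 1)) * 2.
  have [n hn] : exists n, c * 2^-1 ^+ n <= e / 3.
    have /cvgrPdist_le/(_ (e / 3)) := geo c.
    rewrite divr_gt0// => /(_ isT)[n _ /(_ n (leqnn n))] /=.
    rewrite sub0r normrN => hn; exists n; apply: le_trans hn; exact: ler_norm.
  have near_S := @hcont_max _ _ (cS n i j) t.
  move/cvgrPdist_le: near_S => /(_ (e / 3)); rewrite divr_gt0// => /(_ isT) nS.
  have H (s : R) : s < t + 1 -> `|X s i j - S n (Num.max s 0) i j| <= e / 3.
    move=> st; have -> : X s i j = X (Num.max s 0) i j.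
      by rewrite !mxE; congr Y; rewrite [RHS]max_l// le_max lexx orbT.
    apply: le_trans (hX _ _ _ _ _) _; first by rewrite le_max lexx orbT.
    apply: le_trans hn; rewrite /c -[_ * 2]mulrAC ler_pM2r// ?exprn_gt0 ?invr_gt0//.
    rewrite ler_wpM2r// ler_wpM2l// ler_expR ler_wpM2l// ge_max ltW//=.
    by rewrite addr_ge0.
  near=> s.
  have s1 : s < t + 1 by near: s; apply: lt_nbhsl; rewrite ltrDl.
  have h1 := H s s1.
  have h2 := H t (ltr_pwDr ltr01 (lexx t)).
  have h3 : `|S n (Num.max t 0) i j - S n (Num.max s 0) i j| <= e / 3 by near: s.
  move: h1 h2 h3; rewrite !ler_norml => /andP[? ?] /andP[? ?] /andP[? ?].
  by apply/andP; split; lra.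
(* The right-hand side of the integral equation, differentiable by construction; it remains to
   identify it with [X]. *)
pose Z (t : R) i j := X0 i j + prim (fun s => (A s *m X s) i j) t.
have dZ i j : hderive (fun t => Z t i j) (fun t => (A t *m X t) i j).
  apply: hderive_eq (hderiveD (hderive_cst _) (hderive_prim (hcont_mulmx hA cX i j))) _.
  by move=> t _; rewrite add0r.
have dS n i j : hderive (fun t => S n.+1 t i j)
    (fun t => (A t *m \matrix_(i, j) S n t i j) i j).
  elim: n => [|n ih].
    rewrite [X in hderive X](_ : _ = fun=> X0 i j).
      apply: hderive_eq (hderive_cst _) _ => t _.
      by rewrite mxE big1// => k _; rewrite mxE /S seriesEnat/= big_nil mulr0.
    by apply/funext => t; rewrite /S seriesEnat/= big_nat1.
  have -> : (fun t => S n.+2 t i j) = (fun t => S n.+1 t i j + E n.+1 t i j).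
    by apply/funext => t; rewrite /S !seriesEnat/= [LHS]big_nat_recr.
  apply: hderive_eq (hderiveD ih (dE n i j)) _ => t _.
  rewrite !mxE -big_split/=; apply: eq_bigr => k _.
  by rewrite !mxE -mulrDr /S !seriesEnat/= [in RHS]big_nat_recr.
(* [S n.+1] and [Z] agree at 0 and their derivatives differ by [A (S n - X)]; hence at each fixed
   time [S n.+1] is within O(2^-n) of both [X] and [Z]. *)
have XZ (t : R) i j : 0 <= t -> X t i j = Z t i j.
  move=> t0; apply/eqP; rewrite -subr_eq0 -normr_le0.
  pose c := (1 + t * (m%:R * K)) * (b * expR (l * t) * 2).
  have H n : `|X t i j - Z t i j| <= c * 2^-1 ^+ n.
    have e0 : S n.+1 0 i j = Z 0 i j.
      rewrite /Z prim0 addr0 /S seriesEnat/= big_nat_recl//= big1 ?addr0// => k _.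
      by rewrite mxE prim0.
    have hid : hderive (fun t : R => t) (fun=> 1).
      by split=> s _; [exact: cvg_id|exact: is_derive_id].
    pose d := m%:R * K * (b * expR (l * t) * 2^-1 ^+ n * 2).
    have := hderive_cmp (hderiveD (dS n i j) (hderiveN (dZ i j)))
              (hderiveM (hderive_cst d) hid) t0.
    rewrite e0 subrr mulr0 !subr0 => h.
    have {h} := h _; set Q := (X in (X -> _) -> _) => h.
    have q : Q.
      move=> s s0 st; rewrite mul0r add0r mulr1.
      rewrite -[X in `|X|](_ : (A s *m (\matrix_(i, j) S n s i j - X s)) i j = _); last first.
        by rewrite mulmxBr !mxE.
      apply: mulmx_entry_le; [exact: K0|exact: hK (ltW s0)|] => i' j'.
      rewrite !mxE -normrN opprB; have := hX s i' j' n (ltW s0).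
      rewrite mxE => /le_trans; apply.
      rewrite ler_wpM2r// ler_wpM2r ?exprn_ge0 ?invr_ge0// ler_wpM2l// ler_expR.
      by rewrite ler_wpM2l// ltW.
    have {q}h := h q; have h1 := hX t i j n.+1 t0.
    have h2 : b * expR (l * t) * 2^-1 ^+ n.+1 * 2 <= b * expR (l * t) * 2 * 2^-1 ^+ n.
      rewrite [leRHS]mulrAC ler_wpM2r//.
      rewrite ler_wpM2l ?mulr_ge0 ?expR_ge0// exprS.
      by rewrite ler_piMl ?exprn_ge0 ?invr_ge0// invf_le1 ?ler1n.
    have -> : c * 2^-1 ^+ n = d * t + b * expR (l * t) * 2 * 2^-1 ^+ n.
      by rewrite /c /d; ring.
    move: h h1; rewrite !ler_norml => /andP[? ?] /andP[? ?].
    by apply/andP; split; lra.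
  have := geo c => g0.
  rewrite -(cvg_lim _ g0)//; apply: limr_ge; first by apply/cvg_ex; exists 0.
  exact: nearW.
exists X; split.
  by apply/matrixP => i j; rewrite XZ// /Z prim0 addr0.
move=> i j; split=> // t t0.
apply: near_eq_is_derive ((dZ i j).2 t t0).
near=> s; rewrite XZ//; apply: ltW; near: s; exact: lt_nbhsr.
Unshelve. all: by end_near. Qed.

(** * Lower central series and adapted bases *)

(** A coordinate of the bracket as a bilinear form: a change of basis is then a congruence in the
    arguments and a linear combination over [l]. *)
Definition bmx (R : realType) (N : nat) (c : bracket R N) (l : 'I_N) : 'M[R]_N :=
  \matrix_(i, j) c i j l.

(* [g . c = g c(h _, h _)], meant for [h = g^-1]. *)
Definition push (R : realType) (N : nat) (g h : 'M[R]_N) (c : bracket R N)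
    (k : 'I_N) : 'M[R]_N :=
  \sum_l g k l *: (h^T *m bmx c l *m h).

(** The matrix of ad e_i for row vectors: [y *m admx c i] is [e_i, y], so images of subspaces are
    products of row spaces. *)
Definition admx (R : realType) (N : nat) (c : bracket R N) (i : 'I_N) : 'M[R]_N :=
  \matrix_(j, k) c i j k.

Definition brr (R : realType) (N : nat) (c : bracket R N) (x y : 'rV[R]_N) : 'rV[R]_N :=
  \sum_i x 0 i *: (y *m admx c i).

(* [lcsmx c k] spans the [k.+1]-st term of the lower central series. *)
Fixpoint lcsmx (R : realType) (N : nat) (c : bracket R N) (k : nat) : 'M[R]_N :=
  if k is k'.+1 then (\sum_i (lcsmx c k' *m admx c i))%MS else 1%:M.

Lemma brrE (R : realType) (N : nat) (c : bracket R N) (x y : 'rV[R]_N) k :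
  brr c x y 0 k = brapp c (x 0) (y 0) k.
Proof.
rewrite /brr summxE; apply: eq_bigr => i _; rewrite !mxE mulr_sumr.
by apply: eq_bigr => j _; rewrite !mxE mulrA.
Qed.

Lemma brr_delta (R : realType) (N : nat) (c : bracket R N) i (y : 'rV[R]_N) :
  brr c (delta_mx 0 i) y = y *m admx c i.
Proof.
rewrite /brr (bigD1 i)//= big1 ?addr0 => [|j ji].
  by rewrite mxE !eqxx scale1r.
by rewrite mxE eqxx (negbTE ji) scale0r.
Qed.

Lemma brr_suml (R : realType) (N : nat) (c : bracket R N) (I : finType)
    (a : I -> R) (x : I -> 'rV[R]_N) y :
  brr c (\sum_i a i *: x i) y = \sum_i a i *: brr c (x i) y.
Proof.
rewrite /brr; under [RHS]eq_bigr do rewrite scaler_sumr.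
rewrite exchange_big/=; apply: eq_bigr => k _; rewrite summxE scaler_suml.
by apply: eq_bigr => i _; rewrite !mxE scalerA.
Qed.

Lemma brr_sumr (R : realType) (N : nat) (c : bracket R N) (I : finType)
    (a : I -> R) x (y : I -> 'rV[R]_N) :
  brr c x (\sum_i a i *: y i) = \sum_i a i *: brr c x (y i).
Proof.
rewrite /brr; under [RHS]eq_bigr do rewrite scaler_sumr.
rewrite exchange_big/=; apply: eq_bigr => k _; rewrite mulmx_suml scaler_sumr.
by apply: eq_bigr => i _; rewrite -scalemxAl !scalerA mulrC.
Qed.

Lemma brr_suml1 (R : realType) (N : nat) (c : bracket R N) (I : finType)
    (x : I -> 'rV[R]_N) y :
  brr c (\sum_i x i) y = \sum_i brr c (x i) y.
Proof.
by rewrite /brr exchange_big/=; apply: eq_bigr => k _; rewrite summxE scaler_suml.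
Qed.

Lemma brr_skew (R : realType) (N : nat) (c : bracket R N) x y :
  Defs.skew c -> brr c x y = - brr c y x.
Proof.
move=> sk; apply/rowP => k; rewrite [RHS]mxE !brrE /brapp exchange_big/= -sumrN.
apply: eq_bigr => j _; rewrite -sumrN; apply: eq_bigr => i _.
by rewrite sk mulrN [y 0 j * _]mulrC.
Qed.

Lemma brr_leibniz (R : realType) (N : nat) (c : bracket R N) x y z :
  Defs.skew c -> jacobi c ->
  brr c (brr c x y) z = brr c x (brr c y z) - brr c y (brr c x z).
Proof.
move=> sk ja.
have J : brr c (brr c x y) z + brr c (brr c y z) x + brr c (brr c z x) y = 0.
  apply/rowP => k; rewrite !mxE.
  by rewrite -[RHS](ja (x 0) (y 0) (z 0) k) !brrE; congr (_ + _ + _);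
    congr brapp; apply/funext => i; rewrite brrE.
have E1 : brr c (brr c y z) x = - brr c x (brr c y z) by exact: brr_skew.
have E2 : brr c (brr c z x) y = brr c y (brr c x z).
  rewrite brr_skew// [brr c z x]brr_skew//.
  have := brr_sumr c (fun _ : 'I_1 => -1) y (fun=> brr c x z).
  by rewrite !big_ord1 !scaleN1r => ->; rewrite opprK.
by move: J; rewrite E1 E2 => /eqP; rewrite -addrA addr_eq0 opprD opprK => /eqP.
Qed.

Lemma lcsmx_admx (R : realType) (N : nat) (c : bracket R N) k i (y : 'rV[R]_N) :
  (y <= lcsmx c k)%MS -> (y *m admx c i <= lcsmx c k.+1)%MS.
Proof.
move=> hy /=; apply: submx_trans (submxMr _ hy) _.
exact: (sumsmx_sup i).
Qed.

(** Induction on [a]: a generator [e_i, x'] is opened by the Leibniz rule into [e_i, [x', y]] - [x',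
    [e_i, y]], and in both terms x' lies one step lower. The extra 1 comes from counting the series
    from 0. *)
Lemma lcsmx_brr (R : realType) (N : nat) (c : bracket R N) a b (x y : 'rV[R]_N) :
  Defs.skew c -> jacobi c -> (x <= lcsmx c a)%MS -> (y <= lcsmx c b)%MS ->
  (brr c x y <= lcsmx c (a + b).+1)%MS.
Proof.
move=> sk ja; elim: a b x y => [|a ih] b x y hx hy.
  apply: summx_sub => i _; apply: scalemx_sub.
  by rewrite add0n; apply: lcsmx_admx.
have /sub_sumsmxP[u ->] := hx.
rewrite brr_suml1; apply: summx_sub => i _.
rewrite mulmxA -brr_delta brr_leibniz//; apply: addmx_sub.
  rewrite brr_delta addSn; apply: lcsmx_admx; apply: ih => //.
  exact: submxMl.
rewrite eqmx_opp addSnnS; apply: ih; first exact: submxMl.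
by rewrite brr_delta; apply: lcsmx_admx.
Qed.

Lemma lcsmxS (R : realType) (N : nat) (c : bracket R N) k :
  (lcsmx c k.+1 <= lcsmx c k)%MS.
Proof.
elim: k => [|k ih]; first exact: submx1.
by rewrite [X in (X <= _)%MS]/=; apply: sumsmxS => i _; apply: submxMr.
Qed.

Lemma lcs_eq (R : realType) (N : nat) (c : bracket R N) x x' m :
  (forall k, (k <= m)%N -> x k = x' k) -> lcs c x m = lcs c x' m.
Proof.
elim: m => [|m ih] h /=; first exact: h.
by rewrite ih ?h// => k km; apply: h; rewrite leqW.
Qed.

(** Linear functionals translate between iterated brackets, in which nilpotency is stated, and row
    spaces. The induction replaces [phi] by its composite with ad e_i, and e_i becomes the last
    entry of the sequence. *)
Lemma lcsmx_kernel (R : realType) (N : nat) (c : bracket R N) k (phi : 'cV[R]_N) :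
  (forall x, (\row_j lcs c x k j) *m phi = 0) -> lcsmx c k *m phi = 0.
Proof.
elim: k phi => [|k ih] phi h.
  apply/row_matrixP => i; rewrite row0 mul1mx.
  have := h (fun _ j => (j == i)%:R).
  move=> /rowP/(_ 0); rewrite !mxE => e.
  apply/rowP => z; rewrite !mxE (ord1 z) -[RHS]e (bigD1 i)//= mxE eqxx mul1r.
  by rewrite big1 ?addr0// => j ji; rewrite mxE (negbTE ji) mul0r.
apply/sub_kermxP/sumsmx_subP => i _; apply/sub_kermxP; rewrite -mulmxA.
apply: ih => x; rewrite mulmxA -brr_delta.
rewrite -(h (fun j => if j == k.+1 then (fun j => (j == i)%:R) else x j)).
congr (_ *m _); apply/rowP => j; rewrite brrE mxE /= eqxx.
congr brapp; first by apply/funext => z; rewrite mxE eqxx.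
apply/funext => z; rewrite mxE.
apply: (congr1 (fun f : vec R N => f z)); apply: lcs_eq => l lk.
by rewrite ltn_eqF.
Qed.

Lemma lcsmx_nilpotent (R : realType) (N : nat) (c : bracket R N) :
  nilpotent c -> exists m, lcsmx c m = 0.
Proof.
move=> [m hm]; exists m; apply/matrixP => i j.
have : lcsmx c m *m delta_mx j 0 = 0 :> 'cV_N.
  apply: lcsmx_kernel => x.
  by rewrite [X in X *m _](_ : _ = 0) ?mul0mx//; apply/rowP => z; rewrite !mxE hm.
by rewrite -colE => /colP/(_ i); rewrite !mxE.
Qed.

(** Built from the bottom: the empty basis of [L m], then at each step up a basis of a complement,
    whose vectors receive the new level. The last clause says that expansions in the basis detect
    the filtration. *)
Lemma filtration_basis (R : realType) (N : nat) (L : nat -> 'M[R]_N) m :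
  (forall k, (L k.+1 <= L k)%MS) -> L m = 0 -> forall k, (k <= m)%N ->
  exists r (B : 'M[R]_(r, N)) (w : 'I_r -> nat),
    [/\ row_free B, (B <= L k)%MS, forall i, (k <= w i)%N,
        forall i, (row i B <= L (w i))%MS &
        forall l (v : 'rV[R]_N), (k <= l)%N -> (v <= L l)%MS ->
          exists2 u : 'rV_r, v = u *m B & forall i, u 0 i != 0 -> (l <= w i)%N].
Proof.
move=> mono Lm k km; rewrite -(subKn km); elim: (m - k)%N (leq_subr k m) => [_|d ih dm].
  exists 0%N, 0, (fun=> 0%N); rewrite subn0; split=> //.
  - by rewrite /row_free mxrank0.
  - by rewrite sub0mx.
  - by case.
  - by case.
  - have monol l : (m <= l)%N -> (L l <= L m)%MS.
      elim: l => [|l ihl]; first by rewrite leqn0 => /eqP ->.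
      rewrite leq_eqVlt => /predU1P[->//|ml].
      by apply: submx_trans (mono l) (ihl _).
    move=> l v ml vl; exists 0; last by case.
    rewrite mul0mx; apply/eqP; rewrite -submx0 -Lm.
    exact: submx_trans vl (monol _ ml).
have {ih} [r [B [w [fB BL wk rB cB]]]] := ih (ltnW dm).
set k' := (m - d.+1)%N; have k'E : (m - d)%N = k'.+1 by rewrite /k' subnSK.
rewrite k'E in BL wk rB cB.
have LB : (L k'.+1 :=: B)%MS.
  apply/eqmxP; rewrite BL andbT; apply/rV_subP => v vL.
  by have [u -> _] := cB _ _ (leqnn _) vL; apply: submxMl.
set D := (L k' :\: L k'.+1)%MS.
exists (r + \rank D)%N, (col_mx B (row_base D)),
  (fun i => match fintype.split i with inl j => w j | inr _ => k' end).
have DL : (D <= L k')%MS by exact: diffmxSl.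
split.
- rewrite /row_free -addsmxE mxrank_disjoint_sum ?eq_row_base; last first.
    apply/eqP; rewrite -submx0 -(capmx_diff (L k') (L k'.+1)) capmxC.
    by rewrite capmxS// ?LB// eq_row_base.
  by rewrite (eqP fB).
- by rewrite col_mx_sub (submx_trans BL (mono _)) eq_row_base.
- by move=> i; case: (fintype.split i) => // j; apply: ltnW (wk j).
- move=> i; rewrite -[i in row i _]splitK; case: (fintype.split i) => j /=.
    by rewrite rowKu.
  by rewrite rowKd; apply: submx_trans (row_sub _ _) _; rewrite eq_row_base.
(* At the new level all levels are admissible and only spanning matters; deeper vectors already lie
   in the span of the old basis and get coefficient 0 on the appended vectors. *)
- move=> l v; rewrite leq_eqVlt => /predU1P[<-|kl] vl.
    have : (v <= col_mx B (row_base D))%MS.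
      rewrite -addsmxE; apply: submx_trans vl _.
      rewrite -(addsmx_diff_cap_eq (L k') (L k'.+1)) addsmxC.
      by rewrite addsmxS// ?eq_row_base// -LB capmxSr.
    move=> /submxP[u ->]; exists u => // i _; case: (fintype.split i) => // j.
    exact: ltnW (wk j).
  have [u -> hu] := cB _ _ kl vl.
  exists (row_mx u 0); first by rewrite mul_row_col mul0mx addr0.
  move=> i; rewrite -{1}[i]splitK; case: (fintype.split i) => j /=.
    by rewrite row_mxEl; apply: hu.
  by rewrite row_mxEr mxE eqxx.
Qed.

(** The last clause is the dual form of generation by the first layer: for k > 1 no nonzero
    functional on the layer of weight k kills all brackets of layers whose weights add up to k. *)
Lemma adapted_basis (R : realType) (N : nat) (c : bracket R N) :
  Defs.skew c -> jacobi c -> nilpotent c ->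
  exists (g h : 'M[R]_N) (w : 'I_N -> nat),
    [/\ g *m h = 1%:M, forall i, (0 < w i)%N,
        forall i j k, push g h c k i j != 0 -> (w i + w j <= w k)%N &
        forall k (xi : 'rV[R]_N), (1 < k)%N ->
          (forall a, xi 0 a != 0 -> w a = k) ->
          (forall i j, (w i + w j = k)%N -> \sum_a xi 0 a * push g h c a i j = 0) ->
          xi = 0].
Proof.
move=> sk ja ni; have [m Lm] := lcsmx_nilpotent ni.
have [r [B [w [fB _ _ rB cB]]]] := filtration_basis (lcsmxS c) Lm (leq0n m).
have full : row_full B.
  rewrite -sub1mx; apply/rV_subP => v _.
  have [|u -> _] := cB 0%N v (leqnn 0); first exact: submx1.
  exact: submxMl.
have rN : r = N := etrans (esym (eqP fB)) (eqP full).
subst r.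
have uB : B \in unitmx by rewrite -row_free_unit.
have cB' l (v : 'rV_N) : (v <= lcsmx c l)%MS ->
    forall i, (v *m invmx B) 0 i != 0 -> (l <= w i)%N.
  by move=> vl; have [u -> hu] := cB l v (leq0n l) vl; rewrite mulmxK.
have pE i j k : push (invmx B)^T B^T c k i j = (brr c (row i B) (row j B) *m invmx B) 0 k.
  rewrite mxE summxE; apply: eq_bigr => l _; rewrite !mxE mulrC; congr (_ * _).
  rewrite brrE trmxK /brapp exchange_big/=; apply: eq_bigr => b _.
  rewrite !mxE mulr_suml; apply: eq_bigr => a _.
  by rewrite !mxE mulrAC.
(* Levels count the series from 0 and weights from 1; the shift turns the bound of [lcsmx_brr] into
   additivity of weights. *)
exists (invmx B)^T, B^T, (fun i => (w i).+1).
have F1 i j k : push (invmx B)^T B^T c k i j != 0 -> ((w i).+1 + (w j).+1 <= (w k).+1)%N.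
  rewrite pE => /(cB' (w i + w j).+1); rewrite addSn addnS ltnS; apply.
  exact: lcsmx_brr.
split=> //; first by rewrite -trmx_mul mulmxV// trmx1.
move=> [//|[//|l]] xi _ sxi hxi.
(* The functional with value [xi 0 a] on the [a]-th basis vector. Brackets of total weight k are
   killed by hypothesis, those of larger weight because [xi] lives in weight k. *)
pose phi := invmx B *m xi^T.
have bphi i j : (l.+2 <= (w i).+1 + (w j).+1)%N ->
    (brr c (row i B) (row j B) *m phi) = 0.
  move=> lij; apply/rowP => z; rewrite mulmxA [LHS]mxE [RHS]mxE.
  have -> : \sum_a (brr c (row i B) (row j B) *m invmx B) 0 a * xi^T a z
      = \sum_a xi 0 a * push (invmx B)^T B^T c a i j.
    by apply: eq_bigr => a _; rewrite pE [xi^T a z]mxE (ord1 z) mulrC.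
  move: lij; rewrite leq_eqVlt => /predU1P[e|lij]; first by rewrite hxi.
  rewrite big1// => a _; have [->|/F1 h] := eqVneq (push (invmx B)^T B^T c a i j) 0.
    by rewrite mulr0.
  have [->|/sxi e] := eqVneq (xi 0 a) 0; first by rewrite mul0r.
  by move: (leq_trans lij h); rewrite e ltnn.
(* This term of the series is spanned by brackets of e_i with vectors of weight at least k - 1; as
   e_i has weight at least 1, [bphi] applies. The basis vectors of weight k lie in this term, so
   [xi] vanishes. *)
have Lphi : lcsmx c l.+1 *m phi = 0.
  apply/sub_kermxP/sumsmx_subP => i _; apply/sub_kermxP; apply/row_matrixP => j.
  rewrite row0 !row_mul -[row j _ *m _]brr_delta.
  set v := row j (lcsmx c l); set e := delta_mx 0 i : 'rV_N.
  have [u vE hu] := cB l v (leq0n l) (row_sub _ _).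
  rewrite vE -[e](mulmxKV uB) [u *m B]mulmx_sum_row [_ *m invmx B *m B]mulmx_sum_row.
  rewrite brr_suml mulmx_suml big1// => a _.
  rewrite -scalemxAl brr_sumr mulmx_suml big1 ?scaler0// => b _.
  rewrite -scalemxAl; have [->|/hu lb] := eqVneq (u 0 b) 0; first by rewrite scale0r.
  by rewrite bphi ?scaler0// addnS addSn !ltnS (leq_trans lb)// leq_addl.
apply/rowP => a; rewrite mxE.
have [//|/sxi wa] := eqVneq (xi 0 a) 0.
have : row a B *m phi = 0.
  have := rB a; case: wa => ->  /submxP[u ->].
  by rewrite -mulmxA Lphi mulmx0.
rewrite mulmxA -row_mul mulmxV// row1 -rowE => /rowP/(_ 0).
by rewrite !mxE.
Qed.

(** * Polynomial Gram matrices *)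

Definition primp (R : realType) (p : {poly R}) : {poly R} :=
  \poly_(i < (size p).+1) (if i is j.+1 then p`_j / j.+1%:R else 0).

Lemma deriv_primp (R : realType) (p : {poly R}) : deriv (primp p) = p.
Proof.
apply/polyP => i; rewrite coef_deriv coef_poly ltnS.
case: ltnP => [ip|pi]; first by rewrite -[LHS]mulr_natr divfK// pnatr_eq0.
by rewrite mul0rn nth_default.
Qed.

Lemma primp0 (R : realType) (p : {poly R}) : (primp p).[0] = 0.
Proof. by rewrite horner_coef0 coef_poly. Qed.

Lemma size_primp (R : realType) (p : {poly R}) : (size (primp p) <= (size p).+1)%N.
Proof. exact: size_poly. Qed.

(* [tr (c_k G c_l^T G)], written as a sum so that it makes sense for entries in
   any algebra. *)
Definition quadf (R : realType) (N : nat) (A : lalgType R) (c : 'I_N -> 'M[R]_N)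
    (G : 'I_N -> 'I_N -> A) (k l : 'I_N) : A :=
  \sum_i \sum_j \sum_m \sum_n (c k i j * c l n m) *: (G j m * G n i).

Lemma quadf_trace (R : realType) (N : nat) (c : 'I_N -> 'M[R]_N) (G : 'M[R]_N) k l :
  @quadf R N R^o c (fun i j => G i j) k l = \tr (c k *m G *m (c l)^T *m G).
Proof.
rewrite /mxtrace; apply: eq_bigr => i _.
transitivity (\sum_m \sum_n \sum_j c k i j * G j m * c l n m * G n i).
  rewrite exchange_big; apply: eq_bigr => m _; rewrite exchange_big.
  by apply: eq_bigr => n _; apply: eq_bigr => j _; rewrite /GRing.scale/=; ring.
rewrite exchange_big/= mxE; apply: eq_bigr => n _; rewrite mxE mulr_suml.
apply: eq_bigr => m _; rewrite !mxE !mulr_suml; by apply: eq_bigr => j _.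
Qed.

(** This is the triangularity: weights being positive, both factors in a term of the equation for
    G_kl have strictly smaller weight than G_kl. *)
Lemma quadf_weight (R : realType) (N : nat) (c : 'I_N -> 'M[R]_N) (w : 'I_N -> nat) :
  (forall i j k, c k i j != 0 -> (w i + w j <= w k)%N) ->
  forall k l i j m n, c k i j * c l n m != 0 ->
  (minn (w j) (w m) + minn (w n) (w i) <= minn (w k) (w l))%N.
Proof.
move=> F1 k l i j m n; rewrite mulf_eq0 negb_or => /andP[/F1 h1 /F1 h2].
rewrite leq_min; apply/andP; split.
  by apply: leq_trans h1; rewrite addnC leq_add ?geq_minl ?geq_minr.
by apply: leq_trans h2; rewrite addnC leq_add ?geq_minl ?geq_minr.
Qed.

(** Induction on the weight of an entry. A product of two factors has degree at most the weight
    minus 2, so one integration keeps the degree below the weight. *)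
Lemma poly_flow (R : realType) (N : nat) (c : 'I_N -> 'M[R]_N) (w : 'I_N -> nat)
    (G0 : 'M[R]_N) :
  (forall i, (0 < w i)%N) ->
  (forall i j k, c k i j != 0 -> (w i + w j <= w k)%N) ->
  exists G : 'I_N -> 'I_N -> {poly R},
    [/\ forall k l, (G k l).[0] = G0 k l,
        forall k l, deriv (G k l) = quadf c G k l &
        forall k l, (size (G k l) <= minn (w k) (w l))%N].
Proof.
move=> w0 F1.
have wmin k l : (0 < minn (w k) (w l))%N by rewrite leq_min !w0.
have H n : exists G : 'I_N -> 'I_N -> {poly R},
    [/\ forall k l, (G k l).[0] = G0 k l,
        forall k l, (minn (w k) (w l) <= n)%N -> deriv (G k l) = quadf c G k l &
        forall k l, (size (G k l) <= minn (w k) (w l))%N].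
  elim: n => [|n [G [hG0 hG sG]]].
    exists (fun k l => (G0 k l)%:P); split=> k l; first by rewrite hornerC.
      by rewrite leqn0 => /eqP e; move: (wmin k l); rewrite e.
    by apply: leq_trans (size_polyC_leq1 _) (wmin k l).
  (* All entries of weight above [n] are overwritten, but only those of weight [n.+1] are final;
     [GG'] says that their right-hand side sees none of the overwritten ones. *)
  pose G' k l := if (minn (w k) (w l) <= n)%N then G k l
                 else (G0 k l)%:P + primp (quadf c G k l).
  have GG' k l : (minn (w k) (w l) <= n.+1)%N -> quadf c G k l = quadf c G' k l.
    move=> kl; apply: eq_bigr => i _; apply: eq_bigr => j _.
    apply: eq_bigr => m _; apply: eq_bigr => z _.
    have [->|/(quadf_weight F1) h] := eqVneq (c k i j * c l z m) 0.
      by rewrite !scale0r.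
    move: (leq_trans h kl); set x := minn _ _; set y := minn _ _ => xy.
    have x0 : (0 < x)%N by exact: wmin.
    have y0 : (0 < y)%N by exact: wmin.
    rewrite /G' -/x -/y.
    have -> : (x <= n)%N by rewrite -ltnS (leq_trans _ xy)// -addn1 leq_add2l.
    have -> // : (y <= n)%N by rewrite -ltnS (leq_trans _ xy)// -add1n leq_add2r.
  exists G'; split=> k l.
  - rewrite /G'; case: ifP => // _.
    by rewrite hornerD hornerC primp0 addr0.
  - move=> kl; rewrite -GG'// /G'; case: ifP => [kn|_]; first exact: hG.
    by rewrite derivD derivC add0r deriv_primp.
  - rewrite /G'; case: ifP => // _.
    apply: leq_trans (size_polyD _ _) _; rewrite geq_max.
    rewrite (leq_trans (size_polyC_leq1 _) (wmin k l))/=.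
    apply: leq_trans (size_primp _) _; rewrite -(prednK (wmin k l)) ltnS.
    apply: leq_trans (size_sum _ _ _) _; apply/bigmax_leqP => i _.
    apply: leq_trans (size_sum _ _ _) _; apply/bigmax_leqP => j _.
    apply: leq_trans (size_sum _ _ _) _; apply/bigmax_leqP => m _.
    apply: leq_trans (size_sum _ _ _) _; apply/bigmax_leqP => z _.
    have [->|/(quadf_weight F1) h] := eqVneq (c k i j * c l z m) 0.
      by rewrite scale0r size_poly0.
    apply: leq_trans (size_scale_leq _ _) _; apply: leq_trans (size_polyMleq _ _) _.
    rewrite -!subn1 leq_sub2r//; apply: leq_trans h.
    by rewrite leq_add.
have [G [h1 h2 h3]] := H (\max_k w k)%N.
exists G; split=> // k l; apply: h2; apply: leq_trans (geq_minl _ _) _.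
exact: leq_bigmax.
Qed.

(** Triangularity replaces a uniqueness theorem: by strong induction on the weight the right-hand
    sides agree, so the difference of the two sides has zero derivative. *)
Lemma poly_flow_eval (R : realType) (N : nat) (c : 'I_N -> 'M[R]_N) (w : 'I_N -> nat)
    (G : R -> 'M[R]_N) (GG : 'I_N -> 'I_N -> {poly R}) (s ds : R -> R) :
  (forall i, (0 < w i)%N) ->
  (forall i j k, c k i j != 0 -> (w i + w j <= w k)%N) ->
  (forall k l, (GG k l).[0] = G 0 k l) ->
  (forall k l, deriv (GG k l) = quadf c GG k l) ->
  s 0 = 0 -> hderive s ds ->
  (forall k l, hderive (fun t => G t k l)
     (fun t => \tr (c k *m G t *m (c l)^T *m G t) * ds t)) ->
  forall t : R, 0 <= t -> forall k l, G t k l = (GG k l).[s t].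
Proof.
move=> w0 F1 hGG0 hGG s0 hs hG t t0 k l; move: t t0.
have wmin i j : (0 < minn (w i) (w j))%N by rewrite leq_min !w0.
have [n] := ubnP (minn (w k) (w l)); elim: n k l => // n ih k l kl t t0.
have hd := hderiveD (hG k l) (hderiveN (@hderive_comp _ _ _ _ _ (is_derive_poly (GG k l)) hs)).
have /(hderive_eq hd)/hderive0/(_ t t0) : forall u : R, 0 < u ->
    \tr (c k *m G u *m (c l)^T *m G u) * ds u - (deriv (GG k l)).[s u] * ds u = 0.
  move=> u u0; rewrite -mulrBl hGG -quadf_trace /quadf.
  rewrite [X in X * _](_ : _ = 0) ?mul0r//; apply/eqP; rewrite subr_eq0; apply/eqP.
  rewrite horner_sum; apply: eq_bigr => i _; rewrite horner_sum; apply: eq_bigr => j _.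
  rewrite horner_sum; apply: eq_bigr => m _; rewrite horner_sum; apply: eq_bigr => z _.
  rewrite hornerZ hornerM.
  have [->|/(quadf_weight F1) h] := eqVneq (c k i j * c l z m) 0.
    by rewrite scale0r mul0r.
  have xy := leq_trans h (kl : minn _ _ <= n)%N; congr (_ * (_ * _)); apply: ih (ltW u0).
    by apply: leq_trans xy; rewrite -addn1 leq_add2l.
  by apply: leq_trans xy; rewrite -add1n leq_add2r.
by rewrite s0 hGG0 subrr => /eqP; rewrite subr_eq0 => /eqP.
Qed.

Lemma cvg_expn0 (R : realType) (e : nat -> R) k :
  (e n @[n --> \oo] --> 0) -> (e n ^+ k @[n --> \oo] --> ((k == 0%N)%:R : R)).
Proof.
move=> e0; case: k => [|k]; first exact: cvg_cst.
elim: k => [//|k ih].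
rewrite -[X in _ --> X](mul0r (0 : R)); under eq_fun do rewrite exprS.
exact: cvgM.
Qed.

Lemma cvg_bigsum (R : realType) (I : Type) (r : seq I) (P : pred I)
    (f : I -> nat -> R) (a : I -> R) :
  (forall i, P i -> f i n @[n --> \oo] --> a i) ->
  (\sum_(i <- r | P i) f i n @[n --> \oo] --> \sum_(i <- r | P i) a i).
Proof.
move=> h; elim: r => [|i r ih].
  rewrite big_nil; under eq_fun do rewrite big_nil.
  exact: cvg_cst.
rewrite big_cons; have E : (fun n => \sum_(j <- i :: r | P j) f j n) =
    if P i then (fun n => f i n + \sum_(j <- r | P j) f j n)
    else (fun n => \sum_(j <- r | P j) f j n).
  by apply/funext => n; rewrite big_cons; case: (P i).
rewrite E; move: (h i); case: (P i) => // hi.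
by apply: cvgD => //; apply: hi.
Qed.

(** The monomial of degree i is multiplied by e^(a + b - 2 - 2 i). As i < min(a, b), this exponent
    is nonnegative, and it is 0 only for a = b = i + 1. *)
Lemma poly_scaled_cvg (R : realType) (e : nat -> R) (p : {poly R}) (a b : nat) :
  (e n @[n --> \oo] --> 0) -> (forall n, e n != 0) -> (0 < a)%N -> (0 < b)%N ->
  (size p <= minn a b)%N ->
  (e n ^+ a.-1 * p.[(e n)^-1 ^+ 2] * e n ^+ b.-1 @[n --> \oo] -->
     if a == b then p`_a.-1 else 0).
Proof.
move=> e0 en0; case: a b => [//|a] [//|b] _ _ /=; rewrite eqSS => sp.
have E n : e n ^+ a * p.[(e n)^-1 ^+ 2] * e n ^+ b =
    \sum_(i < minn a.+1 b.+1) p`_i * e n ^+ (a + b - i.*2).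
  rewrite (horner_coef_wide _ sp) mulr_sumr mulr_suml; apply: eq_bigr => i _.
  have := ltn_ord i; rewrite leq_min !ltnS => /andP[ia ib].
  have iab : (i.*2 <= a + b)%N by rewrite -addnn leq_add.
  rewrite -exprM mul2n mulrCA -!mulrA; congr (_ * _).
  rewrite mulrA mulrAC -exprD -[in LHS](subnK iab) exprD -mulrA -exprMn.
  by rewrite mulfV// expr1n mulr1.
under eq_fun do rewrite E.
have -> : (if a == b then p`_a else 0) =
    \sum_(i < minn a.+1 b.+1) p`_i * ((a + b - i.*2)%N == 0%N)%:R.
  case: eqP => [<-|ab].
    rewrite minnn (bigD1 ord_max)//= big1 ?addr0 => [|i].
      by rewrite addnn subnn mulr1.
    move=> /eqP ia; have := ltn_ord i; rewrite ltnS leq_eqVlt => /predU1P[ea|ia'].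
      by case: ia; apply: val_inj.
    by rewrite addnn -doubleB double_eq0 subn_eq0 leqNgt ia' mulr0.
  rewrite big1// => i _; have := ltn_ord i; rewrite leq_min !ltnS => /andP[ia ib].
  rewrite subn_eq0; case: leqP => h; last by rewrite mulr0.
  case: ab; move: h; rewrite -addnn => h.
  have h1 : (a <= i)%N by rewrite -(leq_add2r b) (leq_trans h)// leq_add2l.
  have h2 : (b <= i)%N by rewrite -(leq_add2l a) (leq_trans h)// leq_add2r.
  by apply/eqP; rewrite eqn_leq (leq_trans h1 ib) (leq_trans h2 ia).
apply: cvg_bigsum => i _; apply: cvgM; first exact: cvg_cst.
exact: cvg_expn0.
Qed.

(** * Graded brackets *)

Lemma sum_scale_invK (R : realType) (N p r : nat) (g h : 'M[R]_N)
    (M : 'I_N -> 'M[R]_(p, r)) (a : 'I_N) : h *m g = 1%:M ->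
  \sum_k h a k *: (\sum_b g k b *: M b) = M a.
Proof.
move=> hg; under eq_bigr do rewrite scaler_sumr.
rewrite exchange_big/=; transitivity (\sum_b (h *m g) a b *: M b).
  apply: eq_bigr => b _; rewrite mxE scaler_suml.
  by apply: eq_bigr => k _; rewrite scalerA.
rewrite hg (bigD1 a)//= big1 ?addr0 => [|b ba]; first by rewrite mxE eqxx scale1r.
by rewrite mxE eq_sym (negbTE ba) scale0r.
Qed.

Lemma mxtrace_mul_tr (R : realType) (m n : nat) (A B : 'M[R]_(m, n)) :
  \tr (A *m B^T) = \sum_i \sum_j A i j * B i j.
Proof.
by apply: eq_bigr => i _; rewrite mxE; apply: eq_bigr => j _; rewrite mxE.
Qed.

Lemma mxtrace_sqr_eq0 (R : realType) (m n : nat) (A : 'M[R]_(m, n)) :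
  \tr (A *m A^T) = 0 -> A = 0.
Proof.
rewrite mxtrace_mul_tr => h; apply/matrixP => i j; rewrite mxE.
have := h => /eqP; rewrite psumr_eq0 => [|k _]; last first.
  by apply: sumr_ge0 => l _; rewrite -expr2 sqr_ge0.
move=> /allP/(_ i); rewrite mem_index_enum => /(_ isT) /=.
rewrite psumr_eq0 => [|k _]; last by rewrite -expr2 sqr_ge0.
move=> /allP/(_ j); rewrite mem_index_enum => /(_ isT) /=.
by rewrite mulf_eq0 orbb => /eqP.
Qed.

Lemma row_sqr_eq0 (R : realType) (m n : nat) (x : 'rV[R]_m) (V : 'M[R]_(m, n)) :
  x *m (V *m V^T) *m x^T = 0 -> x *m V = 0.
Proof.
move=> h; apply: mxtrace_sqr_eq0.
by rewrite trmx_mul mulmxA -[_ *m V *m _]mulmxA h mxtrace0.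
Qed.

(* A kernel vector of weight [k] of the Gram matrix [L] yields the kernel element
   [Y = \sum_a xi_a c_a] of weight [< k] on both sides, which the induction kills. *)
Lemma graded_gram_free (R : realType) (N : nat) (c : 'I_N -> 'M[R]_N)
    (w : 'I_N -> nat) (V L : 'M[R]_N) :
  (forall i, (0 < w i)%N) -> V *m V^T = L ->
  (forall i j, w i != w j -> L i j = 0) ->
  (forall k l, \tr (c k *m L *m (c l)^T *m L) = (w k).-1%:R * L k l) ->
  (forall i j k, c k i j != 0 -> (w i + w j = w k)%N) ->
  (forall k (xi : 'rV[R]_N), (1 < k)%N -> (forall a, xi 0 a != 0 -> w a = k) ->
     (forall i j, \sum_a xi 0 a * c a i j = 0) -> xi = 0) ->
  (forall xi : 'rV[R]_N, (forall a, xi 0 a != 0 -> w a = 1%N) ->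
     xi *m V = 0 -> xi = 0) ->
  forall xi : 'rV[R]_N, xi *m V = 0 -> xi = 0.
Proof.
move=> w0 VL Lw Lc cw F2 F0.
pose cut (k : nat) (xi : 'rV[R]_N) : 'rV[R]_N := \row_a (if w a == k then xi 0 a else 0).
(* [V] and [L] have the same left kernel, and [L] is block diagonal; so the kernel is the sum of its
   weight components. *)
have cutV (xi : 'rV[R]_N) k : xi *m V = 0 -> cut k xi *m V = 0.
  move=> xV; apply: row_sqr_eq0; rewrite VL.
  suff -> : cut k xi *m L = 0 by rewrite mul0mx.
  have xL : xi *m L = 0 by rewrite -VL mulmxA xV mul0mx.
  apply/rowP => j; rewrite [LHS]mxE [RHS]mxE; have [wj|wj] := eqVneq (w j) k.
    transitivity ((xi *m L) 0 j); last by rewrite xL mxE.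
    rewrite mxE; apply: eq_bigr => i _; rewrite mxE; case: eqP => // wi; rewrite [L i j]Lw ?mulr0//.
    by apply/eqP => e; apply: wi; rewrite e.
  apply: big1 => i _; rewrite mxE; case: eqP => [wi|_]; last by rewrite mul0r.
  by rewrite Lw ?mulr0// wi eq_sym.
have K n : forall xi : 'rV[R]_N, (forall a, xi 0 a != 0 -> (w a <= n)%N) ->
    xi *m V = 0 -> xi = 0.
  elim: n => [|n ih] xi sxi xV.
    apply/rowP => a; rewrite mxE; have [//|/sxi] := eqVneq (xi 0 a) 0.
    by rewrite leqNgt w0.
  have cut0 : cut n.+1 xi = 0.
    have scut a : cut n.+1 xi 0 a != 0 -> w a = n.+1.
      by rewrite mxE; case: (eqVneq (w a) n.+1) => // _ /eqP.
    have cV := cutV xi n.+1 xV.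
    case: n ih sxi scut cV => [|n] ih sxi scut cV; first exact: F0.
    pose Y := \sum_a cut n.+2 xi 0 a *: c a.
    have YE i j : Y i j = \sum_a cut n.+2 xi 0 a * c a i j.
      by rewrite summxE; apply: eq_bigr => a _; rewrite mxE.
    have Yw i j : Y i j != 0 -> (w i + w j = n.+2)%N.
      rewrite YE => Yn; have [a] : exists a, cut n.+2 xi 0 a * c a i j != 0.
        apply: contrapT => /forallNP h; move/eqP: Yn; apply.
        by apply: big1 => a _; apply/eqP; apply: contrapT => /negP; apply: h.
      by rewrite mulf_eq0 negb_or => /andP[/scut <- /cw].
    have Yl i j : Y i j != 0 -> (w i <= n.+1)%N && (w j <= n.+1)%N.
      move=> /Yw e; have := w0 i; have := w0 j.
      move: e; case: (w i) => // p; case: (w j) => // q.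
      by rewrite addSn addnS => -[e] _ _; rewrite !ltnS -e leq_addr leq_addl.
    (* The squared norm of this matrix is tr(Y L Y^T L). By the trace identity it is a combination
       of the entries of [cut n.+2 xi *m L], which vanish. *)
    have Y0 : V^T *m Y *m V = 0.
      apply: mxtrace_sqr_eq0; rewrite !trmx_mul trmxK.
      rewrite [X in \tr X](_ : _ = V^T *m (Y *m L *m Y^T *m V)); last first.
        by rewrite -VL !mulmxA.
      rewrite mxtrace_mulC -!mulmxA VL !mulmxA.
      have -> : Y^T = \sum_b cut n.+2 xi 0 b *: (c b)^T.
        by rewrite /Y linear_sum/=; apply: eq_bigr => b _; rewrite linearZ.
      rewrite mulmx_sumr mulmx_suml raddf_sum big1//= => b _.
      rewrite -scalemxAr -scalemxAl linearZ/=.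
      rewrite /Y !mulmx_suml raddf_sum/=.
      have -> : \sum_a \tr (cut n.+2 xi 0 a *: c a *m L *m (c b)^T *m L) =
          (n.+1)%:R * (cut n.+2 xi *m L) 0 b.
        rewrite mxE mulr_sumr; apply: eq_bigr => a _.
        rewrite -!scalemxAl linearZ/= Lc.
        have [->|/scut ->] := eqVneq (cut n.+2 xi 0 a) 0; first by rewrite !mul0r mulr0.
        by rewrite mulrCA.
      by rewrite -VL mulmxA cV mul0mx [X in _ * (_ * X)]mxE !mulr0.
    (* The factors [V] are cancelled one at a time: the columns of [Y V], and then the rows of [Y],
       are supported in weights at most [n.+1], where the induction hypothesis applies. *)
    have YV : Y *m V = 0.
      apply: trmx_inj; rewrite trmx0; apply/row_matrixP => i; rewrite row0.
      apply: ih => [a|].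
        rewrite !mxE => h.
        have [j] : exists j, Y a j * V j i != 0.
          apply: contrapT => /forallNP h'; move/eqP: h; apply.
          by apply: big1 => j _; apply/eqP; apply: contrapT => /negP; apply: h'.
        by rewrite mulf_eq0 negb_or => /andP[/Yl/andP[]].
      rewrite -row_mul (_ : _ *m V = 0) ?row0//; have /(congr1 trmx) := Y0.
      by rewrite !trmx_mul trmxK trmx0 mulmxA.
    have {}YV : Y = 0.
      apply/row_matrixP => i; rewrite row0; apply: ih => [a|].
        by rewrite mxE => /Yl/andP[].
      by rewrite -row_mul YV row0.
    by apply: (F2 n.+2) => // i j; rewrite -YE YV mxE.
  apply: ih => // a xa; have := sxi a xa; rewrite leq_eqVlt => /predU1P[wa|//].
  by move/rowP: cut0 => /(_ a); rewrite !mxE wa eqxx => e; rewrite e eqxx in xa.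
move=> xi; apply: (K (\max_a w a)%N) => a _; exact: leq_bigmax.
Qed.

Lemma sum_ltn_half (R : realType) (N : nat) (f : 'I_N -> 'I_N -> R) :
  (forall i j, f i j = f j i) -> (forall i, f i i = 0) ->
  \sum_(i < N) \sum_(j < N | (i < j)%N) f i j = 2^-1 * \sum_i \sum_j f i j.
Proof.
move=> fC f0.
have -> : \sum_i \sum_j f i j = \sum_(i < N) \sum_(j < N | (i < j)%N) f i j
    + \sum_(i < N) \sum_(j < N | (j < i)%N) f i j.
  rewrite -big_split/=; apply: eq_bigr => i _.
  rewrite (bigID (fun j : 'I_N => (i < j)%N))/=; congr (_ + _).
  rewrite (bigD1 i) ?ltnn//= f0 add0r; apply: eq_bigl => j.
  by rewrite -leqNgt ltn_neqAle andbC.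
have -> : \sum_(i < N) \sum_(j < N | (j < i)%N) f i j = \sum_(i < N) \sum_(j < N | (i < j)%N) f i j.
  rewrite (exchange_big_dep xpredT)//=; apply: eq_bigr => j _.
  by apply: eq_bigr => i _; rewrite fC.
by field.
Qed.

Lemma Pmx_trace (R : realType) (N : nat) (c : bracket R N) a b : Defs.skew c ->
  Pmx c a b = 2^-1 * \tr (bmx c a *m (bmx c b)^T).
Proof.
move=> sk; rewrite mxE sum_ltn_half => [|i j|i].
- rewrite mxtrace_mul_tr; congr (_ * _).
  by apply: eq_bigr => i _; apply: eq_bigr => j _; rewrite !mxE.
- by rewrite [c i j a]sk [c i j b]sk mulrNN.
- have e : c i i a = 0 by have := sk i i a; lra.
  by rewrite e mul0r.
Qed.

Lemma Pmx_sym (R : realType) (N : nat) (c : bracket R N) : (Pmx c)^T = Pmx c.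
Proof.
apply/matrixP => a b; rewrite !mxE; apply: eq_bigr => i _; apply: eq_bigr => j _.
exact: mulrC.
Qed.

Lemma bmx_pi (R : realType) (N : nat) (A : 'M[R]_N) (c : bracket R N) k :
  bmx (pi_act A c) k = \sum_l A k l *: bmx c l - A^T *m bmx c k - bmx c k *m A.
Proof.
apply/matrixP => i j; rewrite !mxE summxE; congr (_ - _ - _).
- by apply: eq_bigr => l _; rewrite !mxE.
- by apply: eq_bigr => l _; rewrite !mxE.
- by apply: eq_bigr => l _; rewrite !mxE mulrC.
Qed.

(** When the two combinations have the form kappa V^T c_k V, the trace depends on [V] only through V
    V^T. This is how P becomes a function of the Gram matrix. *)
Lemma Pmx_push (R : realType) (N : nat) (c : bracket R N) (V : 'M[R]_N) k l :
  Defs.skew c ->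
  (V *m Pmx c *m V^T) k l =
  2^-1 * \tr ((\sum_a V k a *: bmx c a) *m (\sum_b V l b *: bmx c b)^T).
Proof.
move=> sk; have -> : (\sum_b V l b *: bmx c b)^T = \sum_b V l b *: (bmx c b)^T.
  by rewrite linear_sum/=; apply: eq_bigr => b _; rewrite linearZ.
rewrite mulmx_sumr raddf_sum/= mxE mulr_sumr; apply: eq_bigr => b _.
rewrite -scalemxAr linearZ/= mulmx_suml raddf_sum/= mulrCA mxE [V^T b l]mxE.
rewrite [RHS]mulrC; congr (_ * _); rewrite mulr_sumr; apply: eq_bigr => a _.
by rewrite -scalemxAl linearZ/= Pmx_trace// mulrCA.
Qed.

(** pi(Id) is -1: the value contributes +1 and the two arguments -1 each. *)
Lemma flow_rhs_pi (R : realType) (N : nat) (c : bracket R N) :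
  flow_rhs c = fun i j k => - pi_act (Pmx c) c i j k - alpha c * c i j k.
Proof.
apply/funext => i; apply/funext => j; apply/funext => k; rewrite /flow_rhs.
have D (f : 'I_N -> R) (x : 'I_N) : \sum_l ((alpha c)%:M : 'M[R]_N) x l * f l = alpha c * f x.
  rewrite (bigD1 x)//= big1 ?addr0 => [|l lx]; first by rewrite mxE eqxx mulr1n.
  by rewrite mxE eq_sym (negbTE lx) mulr0n mul0r.
have D' (f : 'I_N -> R) (x : 'I_N) : \sum_l ((alpha c)%:M : 'M[R]_N) l x * f l = alpha c * f x.
  rewrite -D; apply: eq_bigr => l _; congr (_ * _).
  by rewrite !mxE eq_sym.
rewrite /pi_act.
have -> : \sum_l (Pmx c - (alpha c)%:M) k l * c i j l =
    \sum_l Pmx c k l * c i j l - alpha c * c i j k.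
  rewrite -D -sumrB; apply: eq_bigr => l _; rewrite -mulrBl; congr (_ * _).
  by rewrite [LHS]mxE [X in _ + X]mxE.
have -> : \sum_l (Pmx c - (alpha c)%:M) l i * c l j k =
    \sum_l Pmx c l i * c l j k - alpha c * c i j k.
  rewrite -(D' (fun l => c l j k)) -sumrB; apply: eq_bigr => l _; rewrite -mulrBl; congr (_ * _).
  by rewrite [LHS]mxE [X in _ + X]mxE.
have -> : \sum_l (Pmx c - (alpha c)%:M) l j * c i l k =
    \sum_l Pmx c l j * c i l k - alpha c * c i j k.
  rewrite -(D' (fun l => c i l k)) -sumrB; apply: eq_bigr => l _; rewrite -mulrBl; congr (_ * _).
  by rewrite [LHS]mxE [X in _ + X]mxE.
by ring.
Qed.

(** The trace identity reads V P V^T = kappa^2 D V V^T with D = diag((w_k - 1) / 2), and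
    invertibility of [V] cancels V^T. So P is diagonal in the frame, pi(P) nu = (kappa^2 / 2) nu,
    and unit norm forces alpha = - kappa^2 / 2. *)
Lemma graded_fixed_point (R : realType) (N : nat) (c : 'I_N -> 'M[R]_N)
    (w : 'I_N -> nat) (V L : 'M[R]_N) (kappa : R) (nu : bracket R N) :
  (forall i, (0 < w i)%N) -> V *m V^T = L -> V \in unitmx ->
  (forall k l, \tr (c k *m L *m (c l)^T *m L) = (w k).-1%:R * L k l) ->
  (forall i j k, c k i j != 0 -> (w i + w j = w k)%N) ->
  Defs.skew nu -> bdot nu nu = 1 ->
  (forall k, \sum_a V k a *: bmx nu a = kappa *: (V^T *m c k *m V)) ->
  flow_rhs nu = @bzero R N.
Proof.
move=> w0 VL uV Lc cw sk nu1 Nk.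
pose D : 'M[R]_N := diag_mx (\row_k ((w k).-1%:R / 2)).
have VP : V *m Pmx nu = kappa ^+ 2 *: (D *m V).
  have uVT : V^T \in unitmx by rewrite unitmx_tr.
  apply: (can_inj (mulmxK uVT)); rewrite -scalemxAl -[D *m V *m _]mulmxA VL.
  apply/matrixP => k l; rewrite Pmx_push// !Nk linearZ/= -scalemxAl -scalemxAr.
  rewrite !linearZ/= mxE mul_diag_mx !mxE.
  rewrite !trmx_mul trmxK -!mulmxA mxtrace_mulC !mulmxA.
  rewrite -[X in \tr X](_ : c k *m L *m (c l)^T *m L = _); last by rewrite -VL !mulmxA.
  by rewrite Lc; field.
have PV : Pmx nu *m V^T = kappa ^+ 2 *: (V^T *m D).
  apply: trmx_inj; rewrite trmx_mul trmxK Pmx_sym VP linearZ/= trmx_mul trmxK.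
  by rewrite tr_diag_mx.
have piE : pi_act (Pmx nu) nu = bscale (kappa ^+ 2 / 2) nu.
  have W k : \sum_a V k a *: bmx (pi_act (Pmx nu) nu) a =
      (kappa ^+ 2 / 2) *: \sum_a V k a *: bmx nu a.
    under eq_bigr do rewrite bmx_pi !scalerBr.
    rewrite !sumrB.
    have -> : \sum_a V k a *: \sum_l Pmx nu a l *: bmx nu l =
        \sum_l (V *m Pmx nu) k l *: bmx nu l.
      under eq_bigr do rewrite scaler_sumr.
      rewrite exchange_big/=; apply: eq_bigr => l _; rewrite mxE scaler_suml.
      by apply: eq_bigr => a _; rewrite scalerA.
    have -> : \sum_a V k a *: ((Pmx nu)^T *m bmx nu a) =
        Pmx nu *m \sum_a V k a *: bmx nu a.
      by rewrite mulmx_sumr Pmx_sym; apply: eq_bigr => a _; rewrite -scalemxAr.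
    have -> : \sum_a V k a *: (bmx nu a *m Pmx nu) =
        (\sum_a V k a *: bmx nu a) *m Pmx nu.
      by rewrite mulmx_suml; apply: eq_bigr => a _; rewrite -scalemxAl.
    have -> : \sum_l (V *m Pmx nu) k l *: bmx nu l =
        (kappa ^+ 2 * ((w k).-1%:R / 2)) *: \sum_l V k l *: bmx nu l.
      rewrite scaler_sumr; apply: eq_bigr => l _; rewrite VP mxE mul_diag_mx !mxE.
      by rewrite scalerA mulrA.
    rewrite !Nk -scalemxAr !mulmxA PV -!scalemxAl -[_ *m V *m Pmx nu]mulmxA VP.
    rewrite -!scalemxAr !scalerA.
    (* Additivity of weights cancels the w's; the shift by 1 enters once with one sign and twice
       with the other, which leaves 1/2 independently of the layer. *)
    have E : (w k).-1%:R / 2 *: c k - D *m c k - c k *m D = 2^-1 *: c k.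
      apply/matrixP => i j; rewrite mul_diag_mx mul_mx_diag !mxE.
      have [->|/cw e] := eqVneq (c k i j) 0; first by rewrite !mulr0 !mul0r !subr0.
      have n1 x : (w x).-1%:R = (w x)%:R - 1 :> R by rewrite -[in RHS](prednK (w0 x)) -natr1 addrK.
      by rewrite !n1 -e natrD; field.
    rewrite [RHS](_ : _ = (kappa ^+ 2 * kappa) *: (V^T *m (2^-1 *: c k) *m V)); last first.
      by rewrite -scalemxAr -scalemxAl scalerA; congr (_ *: _); ring.
    rewrite -E !mulmxBr !mulmxBl !scalerBr -scalemxAr -scalemxAl scalerA !mulmxA.
    by congr (_ *: _ - _ *: _ - _ *: _); ring.
  have K a : bmx (pi_act (Pmx nu) nu) a = (kappa ^+ 2 / 2) *: bmx nu a.
    have : \sum_k invmx V a k *: (\sum_b V k b *: bmx (pi_act (Pmx nu) nu) b) =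
        (kappa ^+ 2 / 2) *: \sum_k invmx V a k *: \sum_b V k b *: bmx nu b.
      rewrite scaler_sumr; apply: eq_bigr => k _; rewrite W !scalerA; congr (_ *: _).
      exact: mulrC.
    by rewrite !(@sum_scale_invK _ _ _ _ V)// mulVmx.
  apply/funext => i; apply/funext => j; apply/funext => a.
  by have /matrixP/(_ i j) := K a; rewrite !mxE.
have al : alpha nu = - (kappa ^+ 2 / 2).
  rewrite /alpha piE; congr (- _); rewrite -[RHS]mulr1 -nu1 /bdot mulr_sumr.
  apply: eq_bigr => i _; rewrite mulr_sumr; apply: eq_bigr => j _; rewrite mulr_sumr.
  by apply: eq_bigr => k _; rewrite mulrA.
rewrite flow_rhs_pi piE al; apply/funext => i; apply/funext => j; apply/funext => k.
by rewrite /bscale /bzero mulNr opprK addNr.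
Qed.

(** * The moving frame *)

Lemma scalar_linear_ode (R : realType) (f a : R -> R) :
  hcont a -> hderive f (fun t => a t * f t) ->
  forall t : R, 0 <= t -> f t = f 0 * expR (prim a t).
Proof.
move=> ca hf t t0.
have hE := @hderive_comp _ _ _ _ _ (@is_derive_expR R) (hderiveN (hderive_prim ca)).
have H : hderive (fun t => f t * expR (- prim a t)) (fun=> 0).
  by apply: hderive_eq (hderiveM hf hE) _ => u _ /=; ring.
have := hderive0 H t0; rewrite prim0 oppr0 expR0 mulr1 => <-.
by rewrite -mulrA -expRD addNr expR0 mulr1.
Qed.

Definition mderive (R : realType) (m n : nat) (F dF : R -> 'M[R]_(m, n)) :=
  forall i j, hderive (fun t => F t i j) (fun t => dF t i j).

Lemma mderive_eq (R : realType) (m n : nat) (F dF dG : R -> 'M[R]_(m, n)) :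
  mderive F dF -> (forall t : R, 0 < t -> dF t = dG t) -> mderive F dG.
Proof. by move=> hF e i j; apply: hderive_eq (hF i j) _ => t t0; rewrite e. Qed.

Lemma mderiveM (R : realType) (m n p : nat) (F dF : R -> 'M[R]_(m, n))
    (G dG : R -> 'M[R]_(n, p)) : mderive F dF -> mderive G dG ->
  mderive (fun t => F t *m G t) (fun t => dF t *m G t + F t *m dG t).
Proof.
move=> hF hG i j.
have -> : (fun t => (F t *m G t) i j) = (fun t => \sum_k F t i k * G t k j).
  by apply/funext => t; rewrite mxE.
apply: hderive_eq (@hderive_sum _ _ _ xpredT _ _ (fun k _ => hderiveM (hF i k) (hG k j))) _ => t _.
by rewrite !mxE -big_split.
Qed.

Lemma mderive_tr (R : realType) (m n : nat) (F dF : R -> 'M[R]_(m, n)) :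
  mderive F dF -> mderive (fun t => (F t)^T) (fun t => (dF t)^T).
Proof.
move=> hF i j; have -> : (fun t => (F t)^T i j) = (fun t => F t j i).
  by apply/funext => t; rewrite mxE.
by apply: hderive_eq (hF j i) _ => t _; rewrite mxE.
Qed.

Lemma mderiveZ (R : realType) (m n : nat) (f df : R -> R) (F dF : R -> 'M[R]_(m, n)) :
  hderive f df -> mderive F dF ->
  mderive (fun t => f t *: F t) (fun t => df t *: F t + f t *: dF t).
Proof.
move=> hf hF i j; have -> : (fun t => (f t *: F t) i j) = (fun t => f t * F t i j).
  by apply/funext => t; rewrite mxE.
by apply: hderive_eq (hderiveM hf (hF i j)) _ => t _; rewrite !mxE.
Qed.

Lemma mderive_sum (R : realType) (I : finType) (m n : nat)
    (F dF : I -> R -> 'M[R]_(m, n)) : (forall i, mderive (F i) (dF i)) ->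
  mderive (fun t => \sum_i F i t) (fun t => \sum_i dF i t).
Proof.
move=> hF i j; have -> : (fun t => (\sum_k F k t) i j) = (fun t => \sum_k F k t i j).
  by apply/funext => t; rewrite summxE.
by apply: hderive_eq (@hderive_sum _ _ _ xpredT _ _ (fun k _ => hF k i j)) _ => t _; rewrite summxE.
Qed.

Lemma mderive0 (R : realType) (m n : nat) (F : R -> 'M[R]_(m, n)) :
  mderive F (fun=> 0) -> forall t : R, 0 <= t -> F t = F 0.
Proof.
move=> hF t t0; apply/matrixP => i j.
by apply: (hderive0 (f := fun t => F t i j)) => //; apply: hderive_eq (hF i j) _ => u _; rewrite mxE.
Qed.

Definition bhcont (R : realType) (N : nat) (m : R -> bracket R N) :=
  forall i j k, hcont (fun t => m t i j k).

Lemma hcont_Pmx (R : realType) (N : nat) (m : R -> bracket R N) : bhcont m ->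
  forall a b, hcont (fun t => Pmx (m t) a b).
Proof.
move=> hm a b; have -> : (fun t => Pmx (m t) a b) = (fun t =>
    \sum_(i < N) \sum_(j < N | (i < j)%N) m t i j a * m t i j b).
  by apply/funext => t; rewrite mxE.
by do 2![apply: hcont_sum => ? _]; apply: hcontM; apply: hm.
Qed.

Lemma hcont_bdot (R : realType) (N : nat) (m p : R -> bracket R N) :
  bhcont m -> bhcont p -> hcont (fun t => bdot (m t) (p t)).
Proof.
by move=> hm hp; do 3![apply: hcont_sum => ? _]; apply: hcontM; [apply: hm|apply: hp].
Qed.

Lemma hcont_alpha (R : realType) (N : nat) (m : R -> bracket R N) : bhcont m ->
  hcont (fun t => alpha (m t)).
Proof.
move=> hm; apply: hcontN; apply: hcont_bdot => // i j k.
have hP := hcont_Pmx hm.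
apply: hcontD; first apply: hcontD; rewrite ?/(- _); try apply: hcontN;
  by apply: hcont_sum => l _; apply: hcontM; [apply: hP|apply: hm].
Qed.

Lemma bdotDl (R : realType) (N : nat) (c d e : bracket R N) (x y : R) :
  bdot (fun i j k => x * c i j k + y * d i j k) e = x * bdot c e + y * bdot d e.
Proof.
rewrite /bdot !mulr_sumr -big_split; apply: eq_bigr => i _.
rewrite !mulr_sumr -big_split; apply: eq_bigr => j _.
rewrite !mulr_sumr -big_split; apply: eq_bigr => k _ /=.
by rewrite mulrDl !mulrA.
Qed.

Lemma bdot_entry (R : realType) (N : nat) (c : bracket R N) (i j k : 'I_N) :
  (i < j)%N -> c i j k ^+ 2 <= bdot c c.
Proof.
move=> ij; rewrite /bdot (bigD1 i)//= (bigD1 j)//= (bigD1 k)//= expr2 -!addrA lerDl.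
have h (x y : 'I_N) : 0 <= \sum_k c x y k * c x y k.
  by apply: sumr_ge0 => z _; rewrite -expr2 sqr_ge0.
apply: addr_ge0; first by apply: sumr_ge0 => z _; rewrite -expr2 sqr_ge0.
by apply: addr_ge0; apply: sumr_ge0 => x _ //; apply: sumr_ge0 => y _.
Qed.

Lemma sqr_le1_norm (R : realType) (x : R) : x ^+ 2 <= 1 -> `|x| <= 1.
Proof. by rewrite -[x ^+ 2]real_normK ?num_real// expr_le1. Qed.

(** By the choice of [alpha], y = |m|^2 - 1 solves the linear equation y' = - 2 alpha y with y(0) =
    0. *)
Lemma flow_bdot1 (R : realType) (N : nat) (m : R -> bracket R N) :
  (forall i j k, hderive (fun t => m t i j k) (fun t => flow_rhs (m t) i j k)) ->
  bdot (m 0) (m 0) = 1 -> forall t : R, 0 <= t -> bdot (m t) (m t) = 1.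
Proof.
move=> hm m0.
have cm : bhcont m by move=> i j k; case: (hm i j k).
have hb : hderive (fun t => bdot (m t) (m t)) (fun t => 2 * bdot (flow_rhs (m t)) (m t)).
  have H := @hderive_sum _ 'I_N (index_enum _) xpredT _ _ (fun i _ =>
    @hderive_sum _ 'I_N (index_enum _) (fun j => (i < j)%N) _ _ (fun j _ =>
      @hderive_sum _ 'I_N (index_enum _) xpredT _ _ (fun k _ =>
        hderiveM (hm i j k) (hm i j k)))).
  apply: hderive_eq H _ => t _.
  rewrite /bdot mulr_sumr; apply: eq_bigr => i _; rewrite mulr_sumr.
  apply: eq_bigr => j _; rewrite mulr_sumr; apply: eq_bigr => k _; ring.
have hf : hderive (fun t => bdot (m t) (m t) - 1)
    (fun t => (- 2 * alpha (m t)) * (bdot (m t) (m t) - 1)).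
  apply: hderive_eq (hderiveD hb (hderiveN (hderive_cst 1))) _ => t _.
  have -> : flow_rhs (m t) = (fun i j k =>
      (-1) * pi_act (Pmx (m t)) (m t) i j k + (- alpha (m t)) * m t i j k).
    rewrite flow_rhs_pi; apply/funext => i; apply/funext => j; apply/funext => k.
    by ring.
  by rewrite bdotDl /alpha; ring.
move=> t t0; have := scalar_linear_ode _ hf t0; rewrite m0 subrr mul0r => h.
apply/eqP; rewrite -subr_eq0; apply/eqP/h.
by apply: hcontM; [apply: hcont_cst|apply: hcont_alpha].
Qed.

Lemma push_skew (R : realType) (N : nat) (g h : 'M[R]_N) (c : bracket R N) k :
  Defs.skew c -> (push g h c k)^T = - push g h c k.
Proof.
move=> sk; rewrite /push linear_sum/= -sumrN; apply: eq_bigr => l _.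
rewrite linearZ/= !trmx_mul trmxK mulmxA -scalerN; congr (_ *: _).
rewrite -mulNmx -mulmxN; congr (_ *m _ *m _).
by apply/matrixP => i j; rewrite !mxE sk.
Qed.

Lemma push_bscale (R : realType) (N : nat) (g h : 'M[R]_N) (c : bracket R N) r k :
  push g h (bscale r c) k = r *: push g h c k.
Proof.
rewrite /push scaler_sumr; apply: eq_bigr => l _.
have -> : bmx (bscale r c) l = r *: bmx c l by apply/matrixP => i j; rewrite !mxE.
by rewrite -scalemxAr -scalemxAl !scalerA mulrC.
Qed.

(** The motion of the frame contributes the push-forward of pi(P) m, which cancels the same term of
    the flow and leaves - alpha. *)
Lemma push_flow (R : realType) (N : nat) (m : R -> bracket R N) (g h : R -> 'M[R]_N) :
  (forall i j k, hderive (fun t => m t i j k) (fun t => flow_rhs (m t) i j k)) ->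
  mderive g (fun t => g t *m Pmx (m t)) ->
  mderive h (fun t => - (Pmx (m t) *m h t)) ->
  forall k, mderive (fun t => push (g t) (h t) (m t) k)
    (fun t => - alpha (m t) *: push (g t) (h t) (m t) k).
Proof.
move=> hm hg hh k.
have hM l : mderive (fun t => bmx (m t) l) (fun t => bmx (flow_rhs (m t)) l).
  move=> i j; have -> : (fun t => bmx (m t) l i j) = (fun t => m t i j l).
    by apply/funext => t; rewrite mxE.
  by apply: hderive_eq (hm i j l) _ => t _; rewrite mxE.
have H l := mderiveZ (hg k l) (mderiveM (mderiveM (mderive_tr hh) (hM l)) hh).
apply: mderive_eq (mderive_sum H) _ => t _.
set P := Pmx (m t); set X := g t; set Y := h t.
have fE l : bmx (flow_rhs (m t)) l = - bmx (pi_act P (m t)) l - alpha (m t) *: bmx (m t) l.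
  by apply/matrixP => i j; rewrite !mxE flow_rhs_pi.
(* The derivative of [h] cancels the two argument terms of pi; the value term that remains is
   cancelled by the derivative of [g] once the sums are exchanged. *)
have E l : ((- (P *m Y))^T *m bmx (m t) l + Y^T *m bmx (flow_rhs (m t)) l) *m Y
    + Y^T *m bmx (m t) l *m - (P *m Y) =
    - (\sum_a P l a *: (Y^T *m bmx (m t) a *m Y)) - alpha (m t) *: (Y^T *m bmx (m t) l *m Y).
  have -> : \sum_a P l a *: (Y^T *m bmx (m t) a *m Y) =
      Y^T *m (\sum_a P l a *: bmx (m t) a) *m Y.
    rewrite mulmx_sumr mulmx_suml; apply: eq_bigr => a _.
    by rewrite -scalemxAr -scalemxAl.
  rewrite fE bmx_pi; set Z := \sum_a _; set M := bmx (m t) l.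
  rewrite linearN/= trmx_mul !mulNmx mulmxN !mulmxA.
  have -> : Y^T *m (- (Z - P^T *m M - M *m P) - alpha (m t) *: M) =
      - (Y^T *m Z) + Y^T *m P^T *m M + Y^T *m M *m P - alpha (m t) *: (Y^T *m M).
    by rewrite mulmxBr mulmxN !mulmxBr scalemxAr !mulmxA !opprD !opprK.
  rewrite !mulmxDl !mulNmx -scalemxAl.
  set u := _ *m P^T *m _ *m _; set v := _ *m _ *m P *m _; set x := _ *m Z *m _.
  set y := alpha _ *: _.
  by rewrite !addrA [- u - x]addrC subrK [- x + v - y]addrAC addrK.
under eq_bigr do rewrite E.
have -> : \sum_l ((X *m P) k l *: (Y^T *m bmx (m t) l *m Y) +
    X k l *: (- (\sum_a P l a *: (Y^T *m bmx (m t) a *m Y))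
      - alpha (m t) *: (Y^T *m bmx (m t) l *m Y))) =
    \sum_l (X *m P) k l *: (Y^T *m bmx (m t) l *m Y)
    - \sum_l \sum_a (X k l * P l a) *: (Y^T *m bmx (m t) a *m Y)
    - alpha (m t) *: push X Y (m t) k.
  rewrite /push scaler_sumr -!sumrB; apply: eq_bigr => l _.
  rewrite scalerBr scalerN addrA scaler_sumr !scalerA [alpha _ * _]mulrC.
  by congr (_ - _ - _); apply: eq_bigr => a _; rewrite scalerA.
rewrite exchange_big/=.
under [X in _ - X - _]eq_bigr => a _ do rewrite -scaler_suml.
rewrite -sumrB big1 ?sub0r ?scaleNr// => a _.
by rewrite mxE subrr.
Qed.

(** The final identity is g . m = q c with the inverse frame multiplied away, a form that passes to
    limits before the limit frame is known to be invertible. *)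
Lemma flow_gauge (R : realType) (N : nat) (m : R -> bracket R N) (mu : bracket R N)
    (r : R) (g0 h0 : 'M[R]_N) :
  (forall i j k, hderive (fun t => m t i j k) (fun t => flow_rhs (m t) i j k)) ->
  0 < r -> m 0 = bscale r mu -> bdot (m 0) (m 0) = 1 -> Defs.skew mu ->
  g0 *m h0 = 1%:M ->
  exists (g h : R -> 'M[R]_N) (q : R -> R),
    [/\ g 0 = g0, mderive g (fun t => g t *m Pmx (m t)),
        mderive h (fun t => - (Pmx (m t) *m h t)), hcont q &
        forall t : R, 0 <= t ->
        [/\ g t *m h t = 1%:M, 0 < q t, Defs.skew (m t) &
          forall k, \sum_a g t k a *: bmx (m t) a =
            q t *: ((g t)^T *m push g0 h0 mu k *m g t)]].
Proof.
move=> hm r0 m0 m1 sk gh0.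
have cm : bhcont m by move=> i j k; case: (hm i j k).
have cP := hcont_Pmx cm.
(* The number of pairs i < j: unit norm bounds each structure constant by 1, and an entry of P is a
   sum of products of two of them over these pairs. *)
pose K : R := \sum_(i < N) \sum_(j < N | (i < j)%N) 1.
have bP t : 0 <= t -> forall a b, `|Pmx (m t) a b| <= K.
  move=> t0 a b; rewrite mxE; apply: le_trans (ler_norm_sum _ _ _) _.
  apply: ler_sum => i _; apply: le_trans (ler_norm_sum _ _ _) _.
  apply: ler_sum => j ij; rewrite normrM.
  have h c : `|m t i j c| <= 1.
    by apply: sqr_le1_norm; rewrite -(flow_bdot1 hm m1 t0); apply: bdot_entry.
  by rewrite -[leRHS]mulr1 ler_pM.
(* [linear_ode] multiplies by the generator on the left; P being symmetric, the transpose of [g]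
   solves such an equation. *)
have [X [X0 hX]] := linear_ode g0^T cP bP.
have [||h [h00 hh]] := @linear_ode _ _ _ (fun t => - Pmx (m t)) h0 K _ _.
- move=> i j; have -> : (fun t => (- Pmx (m t)) i j) = (fun t => - Pmx (m t) i j).
    by apply/funext => t; rewrite mxE.
  exact: hcontN.
- by move=> t t0 i j; rewrite mxE normrN; apply: bP.
pose g t := (X t)^T.
have hg : mderive g (fun t => g t *m Pmx (m t)).
  apply: mderive_eq (mderive_tr (hX : mderive X _)) _ => t _.
  by rewrite trmx_mul Pmx_sym.
have {}hh : mderive h (fun t => - (Pmx (m t) *m h t)).
  by apply: mderive_eq (hh : mderive h _) _ => t _; rewrite mulNmx.
have g00 : g 0 = g0 by rewrite /g X0 trmxK.
have gh t : 0 <= t -> g t *m h t = 1%:M.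
  move=> t0; rewrite -gh0 -g00 -h00; apply: (mderive0 (F := fun t => g t *m h t)) => //.
  by apply: mderive_eq (mderiveM hg hh) _ => u _; rewrite mulmxN mulmxA subrr.
have ca : hcont (fun t => - alpha (m t)) by apply: hcontN; apply: hcont_alpha.
pose q t := r * expR (prim (fun t => - alpha (m t)) t).
have q0 t : 0 < q t by rewrite mulr_gt0// expR_gt0.
have Ck t k : 0 <= t -> push (g t) (h t) (m t) k = q t *: push g0 h0 mu k.
  move=> t0; apply/matrixP => i j; rewrite [RHS]mxE.
  have hC := push_flow hm hg hh k i j.
  have hC' : hderive (fun t => push (g t) (h t) (m t) k i j)
      (fun t => - alpha (m t) * push (g t) (h t) (m t) k i j).
    by apply: hderive_eq hC _ => u _; rewrite mxE.
  rewrite (scalar_linear_ode ca hC' t0) g00 h00 m0 push_bscale mxE /q; ring.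
have Nk t k : 0 <= t -> \sum_a g t k a *: bmx (m t) a =
    q t *: ((g t)^T *m push g0 h0 mu k *m g t).
  move=> t0; have hg1 : h t *m g t = 1%:M by apply: mulmx1C; apply: gh.
  have -> : push g0 h0 mu k = (q t)^-1 *: push (g t) (h t) (m t) k.
    by rewrite Ck// scalerA mulVf ?scale1r// gt_eqF.
  rewrite -scalemxAr -scalemxAl scalerA mulfV ?gt_eqF// scale1r /push.
  rewrite mulmx_sumr mulmx_suml; apply: eq_bigr => a _.
  rewrite -scalemxAr -scalemxAl; congr (_ *: _).
  by rewrite !mulmxA -trmx_mul hg1 trmx1 mul1mx -mulmxA hg1 mulmx1.
exists g, h, q; split=> //.
  have [cE _] := @hderive_comp _ _ _ _ _ (@is_derive_expR R) (hderive_prim ca).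
  by apply: hcontM => //; apply: hcont_cst.
move=> t t0; split=> //; first exact: gh; last by move=> k; apply: Nk.
have hg1 : h t *m g t = 1%:M by apply: mulmx1C; apply: gh.
(* Skew-symmetry is given at time 0 only; at later times it is read off from [Nk], whose right-hand
   side is skew. *)
have skM a : (bmx (m t) a)^T = - bmx (m t) a.
  have -> : bmx (m t) a = \sum_k h t a k *: (\sum_b g t k b *: bmx (m t) b).
    by rewrite (@sum_scale_invK _ _ _ _ (g t)).
  rewrite linear_sum/= -sumrN; apply: eq_bigr => k _.
  rewrite linearZ/= Nk// linearZ/= !trmx_mul trmxK push_skew// mulNmx mulmxN.
  by rewrite !scalerN mulmxA.
by move=> i j k; have /matrixP/(_ j i) := skM k; rewrite !mxE.
Qed.

(** G' = 2 g P g^T, and the 2 absorbs the one half of [Pmx_push]. *)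
Lemma gram_flow (R : realType) (N : nat) (m : R -> bracket R N) (g : R -> 'M[R]_N)
    (q : R -> R) (c : 'I_N -> 'M[R]_N) :
  mderive g (fun t => g t *m Pmx (m t)) ->
  (forall t : R, 0 <= t -> Defs.skew (m t)) ->
  (forall t : R, 0 <= t -> forall k, \sum_a g t k a *: bmx (m t) a =
     q t *: ((g t)^T *m c k *m g t)) ->
  forall k l, hderive (fun t => (g t *m (g t)^T) k l)
    (fun t => \tr (c k *m (g t *m (g t)^T) *m (c l)^T *m (g t *m (g t)^T)) * q t ^+ 2).
Proof.
move=> hg sk Nk k l.
apply: hderive_eq (mderiveM hg (mderive_tr hg) k l) _ => t t0.
have st := sk _ (ltW t0); have Nt := Nk _ (ltW t0).
rewrite trmx_mul Pmx_sym [g t *m (_ *m _)]mulmxA [LHS]mxE Pmx_push// !Nt linearZ/=.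
rewrite -scalemxAl -scalemxAr !linearZ/= !trmx_mul trmxK.
set A := \tr _; set B := \tr _; have -> : A = B; last by field.
by rewrite /A /B -!mulmxA mxtrace_mulC -!mulmxA.
Qed.

Lemma horner_bounded (R : realType) (p : {poly R}) (S : R) :
  exists B : R, forall x, 0 <= x -> x <= S -> `|p.[x]| <= B.
Proof.
exists (\sum_(i < size p) `|p`_i| * S ^+ i) => x x0 xS.
rewrite horner_coef; apply: le_trans (ler_norm_sum _ _ _) _; apply: ler_sum => i _.
rewrite normrM ler_wpM2l// normrX ger0_norm// lerXn2r// nnegrE//.
exact: le_trans xS.
Qed.

Lemma gram_entry_sqr (R : realType) (m n : nat) (A : 'M[R]_(m, n)) i j :
  A i j ^+ 2 <= (A *m A^T) i i.
Proof.
rewrite mxE (bigD1 j)//= mxE expr2 lerDl; apply: sumr_ge0 => k _.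
by rewrite mxE -expr2 sqr_ge0.
Qed.

Lemma norm_le1D (R : realType) (x b : R) : x ^+ 2 <= b -> `|x| <= 1 + b.
Proof.
move=> h; have b0 : 0 <= b by apply: le_trans h; exact: sqr_ge0.
rewrite -(@ler_pXn2r _ 2) ?nnegrE ?addr_ge0// real_normK ?num_real//.
by apply: le_trans h _; nra.
Qed.

(* As long as the rescaled time stays bounded so do the frame, its inverse and hence
   [m / q], while [m] has unit norm; so [q] is bounded below and time runs off. *)
Lemma rescaled_time_unbounded (R : realType) (N : nat) (m : R -> bracket R N)
    (g h : R -> 'M[R]_N) (q : R -> R) (c : 'I_N -> 'M[R]_N)
    (GG : 'I_N -> 'I_N -> {poly R}) (s : R -> R) :
  mderive h (fun t => - (Pmx (m t) *m h t)) ->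
  (forall t : R, 0 <= t -> bdot (m t) (m t) = 1) ->
  (forall t : R, 0 <= t -> g t *m h t = 1%:M) -> (forall t : R, 0 <= t -> 0 < q t) ->
  (forall t : R, 0 <= t -> forall k, \sum_a g t k a *: bmx (m t) a =
     q t *: ((g t)^T *m c k *m g t)) ->
  s 0 = 0 -> hderive s (fun t => q t ^+ 2) ->
  (forall t : R, 0 <= t -> forall k l, (g t *m (g t)^T) k l = (GG k l).[s t]) ->
  forall M : R, exists T : R, 0 <= T /\ M < s T.
Proof.
move=> hh m1 gh q0 Nk s0 hs hG M; apply: contrapT => /forallNP hM.
have sM t : 0 <= t -> s t <= M.
  by move=> t0; rewrite leNgt; apply/negP => Ms; apply: (hM t).
have sp t : 0 <= t -> 0 <= s t.
  by move=> t0; rewrite -s0; apply: (hderive_mono hs) => // u _ _; exact: sqr_ge0.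
have [bg hbg] : exists b : R, forall t, 0 <= t -> forall i j, `|g t i j| <= b.
  have /choice[B hB] : forall i : 'I_N, exists B : R, forall x, 0 <= x -> x <= M ->
      `|(GG i i).[x]| <= B by move=> i; apply: horner_bounded.
  exists (1 + \sum_i `|B i|) => t t0 i j; apply: norm_le1D.
  apply: le_trans (gram_entry_sqr _ _ _) _; rewrite hG//.
  apply: le_trans (ler_norm _) _; apply: le_trans (hB _ _ (sp _ t0) (sM _ t0)) _.
  apply: le_trans (ler_norm _) _; rewrite (bigD1 i)//= lerDl.
  exact: sumr_ge0.
have [bh hbh] : exists b : R, forall t, 0 <= t -> forall i j, `|h t i j| <= b.
  have dh := mderiveM (mderive_tr hh) hh.
  (* The derivative of h^T h is -2 h^T P h, and P is positive semidefinite: the form written below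
     is a sum of squares. So the inverse frame is bounded without any control of a determinant. *)
  have hdec t i : 0 <= t -> ((h t)^T *m h t) i i <= ((h 0)^T *m h 0) i i.
    move=> t0; rewrite -lerN2; apply: (hderive_mono (hderiveN (dh i i))) => // u u0 _.
    rewrite linearN/= trmx_mul Pmx_sym mulNmx mulmxN mxE !mulmxA.
    set A := _ *m h u; have -> : - ((- A) i i + (- A) i i) = 2 * A i i.
      by rewrite mxE; ring.
    rewrite mulr_ge0// /A.
    have -> : ((h u)^T *m Pmx (m u) *m h u) i i = \sum_(x < N) \sum_(y < N | (x < y)%N)
        (\sum_a h u a i * m u x y a) ^+ 2.
      rewrite mxE; under eq_bigr => b _ do rewrite mxE mulr_suml.
      under eq_bigr => b _ do under eq_bigr => a _ do rewrite !mxE mulr_sumr mulr_suml.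
      under eq_bigr => b _ do under eq_bigr => a _ do under eq_bigr => x _ do
        rewrite mulr_sumr mulr_suml.
      under eq_bigr => b _ do rewrite exchange_big/=.
      rewrite exchange_big/=; apply: eq_bigr => x _.
      under eq_bigr => b _ do rewrite exchange_big/=.
      rewrite exchange_big/=; apply: eq_bigr => y _.
      rewrite expr2 mulr_sumr; apply: eq_bigr => b _; rewrite mulr_suml.
      by apply: eq_bigr => a _; ring.
    by do 2![apply: sumr_ge0 => ? _]; exact: sqr_ge0.
  exists (1 + \sum_i `|((h 0)^T *m h 0) i i|) => t t0 i j; apply: norm_le1D.
  have := gram_entry_sqr (h t)^T j i; rewrite mxE trmxK => /le_trans; apply.
  apply: le_trans (hdec _ j t0) _; apply: le_trans (ler_norm _) _.
  by rewrite (bigD1 j)//= lerDl; apply: sumr_ge0.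
have mE t a : 0 <= t -> bmx (m t) a =
    q t *: \sum_k h t a k *: ((g t)^T *m c k *m g t).
  move=> t0; have hg1 : h t *m g t = 1%:M by apply: mulmx1C; apply: gh.
  rewrite -[LHS](@sum_scale_invK _ _ _ _ (g t) (h t) (bmx (m t)) a hg1).
  rewrite scaler_sumr; apply: eq_bigr => k _; rewrite Nk// !scalerA.
  by rewrite mulrC.
have [bc bc0 hbc] : exists2 b : R, 0 <= b & forall k i j, `|c k i j| <= b.
  have /choice[B hB] : forall k, exists b : R, forall i j, `|c k i j| <= b.
    by move=> k; have [b _ hb] := matrix_bound (c k); exists b.
  exists (\sum_k `|B k|); first exact: sumr_ge0.
  move=> k i j; apply: le_trans (hB _ _ _) _; apply: le_trans (ler_norm _) _.
  by rewrite (bigD1 k)//= lerDl; apply: sumr_ge0.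
pose bg' := `|bg|; pose bh' := `|bh|.
pose b1 := N%:R * bg' * bc; pose b2 := N%:R * b1 * bg'.
have b1p : 0 <= b1 by apply: mulr_ge0 => //; apply: mulr_ge0; rewrite ?ler0n ?normr_ge0.
pose b3 := \sum_(k < N) bh' * b2.
have me t i j a : 0 <= t -> m t i j a ^+ 2 <= q t ^+ 2 * b3 ^+ 2.
  move=> t0; have -> : m t i j a = bmx (m t) a i j by rewrite mxE.
  rewrite mE// mxE exprMn ler_wpM2l ?sqr_ge0// -[leLHS]real_normK ?num_real//.
  have b2p : 0 <= b2 by apply: mulr_ge0; rewrite ?normr_ge0//; apply: mulr_ge0; rewrite ?ler0n.
  rewrite lerXn2r// ?nnegrE//; first by apply: sumr_ge0 => k _; apply: mulr_ge0; rewrite ?normr_ge0.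
  rewrite summxE; apply: le_trans (ler_norm_sum _ _ _) _; apply: ler_sum => k _.
  rewrite mxE normrM ler_pM//; first exact: le_trans (hbh _ t0 _ _) (ler_norm _).
  apply: mulmx_entry_le => // x y; last exact: le_trans (hbg _ t0 _ _) (ler_norm _).
  apply: mulmx_entry_le; [exact: normr_ge0| |exact: hbc] => {}x {}y; rewrite mxE.
  exact: le_trans (hbg _ t0 _ _) (ler_norm _).
pose B := \sum_(i < N) \sum_(j < N | (i < j)%N) \sum_(k < N) b3 ^+ 2.
(* Summing the entry bounds gives 1 = |m|^2 <= q^2 B, so s grows at least like t / B; at time B (M +
   1) it exceeds M. *)
have qB t : 0 <= t -> 1 <= q t ^+ 2 * B.
  move=> t0; rewrite -(m1 _ t0) /bdot /B !mulr_sumr.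
  apply: ler_sum => i _; rewrite mulr_sumr; apply: ler_sum => j _.
  by rewrite mulr_sumr; apply: ler_sum => k _; rewrite -expr2 me.
have B0 : 0 < B.
  rewrite ltNge; apply/negP => Bn; have := qB 0 (lexx 0); rewrite leNgt => /negP; apply.
  by apply: le_lt_trans ltr01; rewrite mulr_ge0_le0// sqr_ge0.
have hid : hderive (fun t : R => t) (fun=> 1).
  by split=> u _; [exact: cvg_id|exact: is_derive_id].
have slin t : 0 <= t -> B^-1 * t <= s t.
  move=> t0; have := hderive_mono (hderiveD hs (hderiveN (hderiveM (hderive_cst B^-1) hid)))
    (lexx 0) t0; rewrite s0 mulr0 subr0 subr_ge0; apply => u u0 _.
  rewrite mul0r add0r mulr1 subr_ge0 -[leLHS]mul1r ler_pdivrMr//.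
  exact: qB (ltW u0).
have M0 : 0 <= M by rewrite -s0 sM.
have := sM (B * (M + 1)); have := slin (B * (M + 1)).
have p0 : 0 <= B * (M + 1) by rewrite mulr_ge0 ?addr_ge0// ltW.
move=> /(_ p0) h1 /(_ p0) /(le_trans h1).
by rewrite mulrA mulVf ?gt_eqF// mul1r gerDl ler10.
Qed.

Lemma bolzano_weierstrass_family (R : realType) (I : finType) (f : I -> nat -> R)
    (B : R) : (forall i n, `|f i n| <= B) ->
  exists phi : nat -> nat, (forall n, (phi n < phi n.+1)%N) /\
    exists l : I -> R, forall i, f i (phi n) @[n --> \oo] --> l i.
Proof.
move=> fB.
have : exists phi : nat -> nat, (forall n, (phi n < phi n.+1)%N) /\
    forall i, i \in enum I -> cvgn (fun n => f i (phi n)).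
  elim: (enum I) => [|i r [phi [iphi cphi]]].
    by exists id; split=> // n.
  have [|psi ipsi cpsi] := @bolzano_weierstrass R (fun n => f i (phi n)).
    exists B; split; first exact: num_real.
    by move=> x Bx n _; apply: le_trans (fB _ _) (ltW Bx).
  have psiS n : (psi n < psi n.+1)%N.
    by have := ipsi n.+1 n; rewrite /Order.le/= ltnn => h; rewrite ltnNge h.
  exists (phi \o psi); split.
    move=> n /=; have hom : {homo phi : x y / (x < y)%N} by apply: homo_ltn => //; exact: ltn_trans.
    exact: hom.
  move=> j; rewrite inE => /predU1P[->//|jr].
  have /cvg_ex[l hl] := cphi _ jr.
  apply/cvg_ex; exists l; apply: (@cvg_comp _ _ _ psi (fun n => f j (phi n))) hl.
  apply/cvgnyPge => A; near=> n.
  have psin : (n <= psi n)%N.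
    by elim: (n) => // k ih; apply: leq_ltn_trans ih (psiS k).
  apply: leq_trans psin; near: n; exact: nbhs_infty_ge.
move=> [phi [iphi cphi]]; exists phi; split=> //.
by exists (fun i => limn (fun n => f i (phi n))) => i; apply: cphi; rewrite mem_enum.
Unshelve. all: by end_near. Qed.

(** * The rescaled limit *)

Definition mcvg (R : realType) (m n : nat) (F : nat -> 'M[R]_(m, n)) (A : 'M[R]_(m, n)) :=
  forall i j, F k i j @[k --> \oo] --> A i j.

Lemma mcvgM (R : realType) (m n p : nat) (F : nat -> 'M[R]_(m, n)) A
    (G : nat -> 'M[R]_(n, p)) B :
  mcvg F A -> mcvg G B -> mcvg (fun k => F k *m G k) (A *m B).
Proof.
move=> hF hG i j; rewrite mxE.
have -> : (fun k => (F k *m G k) i j) = (fun k => \sum_l F k i l * G k l j).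
  by apply/funext => k; rewrite mxE.
by apply: cvg_bigsum => l _; apply: cvgM; [apply: hF|apply: hG].
Qed.

Lemma mcvg_tr (R : realType) (m n : nat) (F : nat -> 'M[R]_(m, n)) A :
  mcvg F A -> mcvg (fun k => (F k)^T) A^T.
Proof.
move=> hF i j; rewrite mxE.
have -> : (fun k => (F k)^T i j) = (fun k => F k j i) by apply/funext => k; rewrite mxE.
exact: hF.
Qed.

Lemma mcvg_trace (R : realType) (n : nat) (F : nat -> 'M[R]_n) A :
  mcvg F A -> \tr (F k) @[k --> \oo] --> \tr A.
Proof. by move=> hF; apply: cvg_bigsum => i _; apply: hF. Qed.

Lemma mcvg_comb (R : realType) (I : finType) (m n : nat) (a : I -> nat -> R)
    (b : I -> R) (F : I -> nat -> 'M[R]_(m, n)) A :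
  (forall i, a i k @[k --> \oo] --> b i) -> (forall i, mcvg (F i) (A i)) ->
  mcvg (fun k => \sum_i a i k *: F i k) (\sum_i b i *: A i).
Proof.
move=> ha hF i j; rewrite summxE.
have -> : (fun k => (\sum_i a i k *: F i k) i j) = (fun k => \sum_x a x k * F x k i j).
  by apply/funext => k; rewrite summxE; apply: eq_bigr => x _; rewrite mxE.
by apply: cvg_bigsum => x _; rewrite mxE; apply: cvgM; [apply: ha|apply: hF].
Qed.

Lemma cvg_uniq (R : realType) (u : nat -> R) (a b : R) :
  (u n @[n --> \oo] --> a) -> (u n @[n --> \oo] --> b) -> a = b.
Proof. by move=> ha hb; rewrite -(cvg_lim _ ha)// -(cvg_lim _ hb). Qed.

Lemma cvg_subseq (R : realType) (u : nat -> R) (a : R) (phi : nat -> nat) :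
  (forall n, (phi n < phi n.+1)%N) ->
  (u n @[n --> \oo] --> a) -> (u (phi n) @[n --> \oo] --> a).
Proof.
move=> iphi ha; apply: (@cvg_comp _ _ _ phi u) ha.
apply/cvgnyPge => A; near=> n.
have phin : (n <= phi n)%N by elim: (n) => // k ih; apply: leq_ltn_trans ih (iphi k).
by apply: leq_trans phin; near: n; exact: nbhs_infty_ge.
Unshelve. all: by end_near. Qed.

Lemma cvg_bounded (R : realType) (u : nat -> R) (a : R) :
  (u n @[n --> \oo] --> a) -> exists B : R, forall n, `|u n| <= B.
Proof.
move=> ua; have /cvg_seq_bounded[B [_ hB]] : cvgn u by apply/cvg_ex; exists a.
by exists (B + 1) => n; apply: hB; rewrite ?ltrDl.
Qed.

Lemma mx_free_unit (R : realType) (n : nat) (V : 'M[R]_n) :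
  (forall x : 'rV[R]_n, x *m V = 0 -> x = 0) -> V \in unitmx.
Proof.
move=> h; rewrite -row_free_unit -kermx_eq0; apply/rowV0P => v.
by move=> /sub_kermxP; apply: h.
Qed.

(** Boundedness of the rescaled frame comes from convergence of its Gram matrix, that of m from unit
    norm; one subsequence serves both, and the frame identity in the limit has the form that
    [graded_fixed_point] takes. *)
Lemma rescaled_limit (R : realType) (N : nat) (m : R -> bracket R N)
    (g : R -> 'M[R]_N) (q : R -> R) (c : 'I_N -> 'M[R]_N) (w : 'I_N -> nat)
    (GG : 'I_N -> 'I_N -> {poly R}) (s : R -> R) :
  (forall i, (0 < w i)%N) ->
  (forall i j k, c k i j != 0 -> (w i + w j <= w k)%N) ->
  (forall k (xi : 'rV[R]_N), (1 < k)%N -> (forall a, xi 0 a != 0 -> w a = k) ->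
     (forall i j, (w i + w j = k)%N -> \sum_a xi 0 a * c a i j = 0) -> xi = 0) ->
  (exists k, c k != 0) -> g 0 \in unitmx ->
  (forall t : R, 0 <= t -> bdot (m t) (m t) = 1) ->
  (forall t : R, 0 <= t -> Defs.skew (m t)) ->
  (forall t : R, 0 <= t -> forall k, \sum_a g t k a *: bmx (m t) a =
     q t *: ((g t)^T *m c k *m g t)) ->
  (forall k l, (GG k l).[0] = (g 0 *m (g 0)^T) k l) ->
  (forall k l, deriv (GG k l) = quadf c GG k l) ->
  (forall k l, (size (GG k l) <= minn (w k) (w l))%N) ->
  (forall t : R, 0 <= t -> forall k l, (g t *m (g t)^T) k l = (GG k l).[s t]) ->
  (forall t u : R, 0 <= t -> t <= u -> s t <= s u) ->
  (forall M : R, exists T : R, 0 <= T /\ M < s T) ->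
  exists tl : nat -> R,
    [/\ forall l, 0 <= tl l, forall l, tl l < tl l.+1, tl @ \oo --> +oo &
      exists nu : bracket R N,
        [/\ nu <> @bzero R N, flow_rhs nu = @bzero R N &
            forall i j k, m (tl l) i j k @[l --> \oo] --> nu i j k]].
Proof.
move=> w0 F1 F2 [k0 ck0] ug m1 sk Nk GG0 dGG sGG hG smono sun.
have [T1 [T1p sT1]] := sun 0.
(* Starting at [T1] makes s positive, so that e = s^(-1/2) is defined and nonzero. *)
pose t (n : nat) : R := T1 + n%:R.
have tp n : 0 <= t n by rewrite addr_ge0.
have st n : 0 < s (t n) by apply: lt_le_trans sT1 _; apply: smono => //; rewrite lerDl.
pose e n := (Num.sqrt (s (t n)))^-1.
have e0 n : 0 < e n by rewrite invr_gt0 sqrtr_gt0.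
have en0 n : e n != 0 by rewrite gt_eqF.
have se n : (e n)^-1 ^+ 2 = s (t n) by rewrite invrK sqr_sqrtr// ltW.
have ecvg : e n @[n --> \oo] --> 0.
  apply/cvgrPdist_le => d d0; have [T [Tp sT]] := sun (d^-1 ^+ 2).
  near=> n; rewrite sub0r normrN gtr0_norm// -[leRHS]invrK lef_pV2 ?posrE ?invr_gt0 ?sqrtr_gt0//.
  rewrite -(@ler_pXn2r _ 2) ?nnegrE ?invr_ge0 ?sqrtr_ge0 ?(ltW d0)// sqr_sqrtr ?(ltW (st n))//.
  apply: le_trans (ltW sT) _; apply: smono => //.
  have Tn : T <= n%:R by near: n; exact: nbhs_infty_ger.
  by apply: le_trans Tn _; rewrite lerDr.
pose U n : 'M[R]_N := \matrix_(k, l) (e n ^+ (w k).-1 * g (t n) k l).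
pose E n : 'M[R]_N := diag_mx (\row_k (e n ^+ (w k).-1)).
have UE n : U n = E n *m g (t n).
  by apply/matrixP => k l; rewrite mul_diag_mx !mxE.
pose L : 'M[R]_N := \matrix_(k, l) (if w k == w l then (GG k l)`_(w k).-1 else 0).
have gramE n : U n *m (U n)^T = E n *m (g (t n) *m (g (t n))^T) *m E n.
  by rewrite UE trmx_mul tr_diag_mx !mulmxA.
have EAE n (A : 'M[R]_N) k l :
    (E n *m A *m E n) k l = e n ^+ (w k).-1 * A k l * e n ^+ (w l).-1.
  by rewrite mul_mx_diag mul_diag_mx !mxE.
have gram_cvg : mcvg (fun n => U n *m (U n)^T) L.
  move=> k l; rewrite mxE.
  have -> : (fun n => (U n *m (U n)^T) k l) = (fun n =>
      e n ^+ (w k).-1 * (GG k l).[(e n)^-1 ^+ 2] * e n ^+ (w l).-1).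
    by apply/funext => n; rewrite gramE EAE hG// se.
  exact: poly_scaled_cvg.
(* Truncated subtraction is harmless: [c k i j] vanishes unless [w i + w j <= w k]. Only the graded
   part [cg] has exponent 0 and survives. *)
pose cn n k : 'M[R]_N := \matrix_(i, j) (e n ^+ (w k - (w i + w j)) * c k i j).
pose cg k : 'M[R]_N := \matrix_(i, j) (if (w i + w j == w k)%N then c k i j else 0).
have cn_cvg k : mcvg (fun n => cn n k) (cg k).
  move=> i j; rewrite mxE.
  have -> : (fun n => cn n k i j) = (fun n => e n ^+ (w k - (w i + w j)) * c k i j).
    by apply/funext => n; rewrite mxE.
  have -> : (if (w i + w j == w k)%N then c k i j else 0) =
      ((w k - (w i + w j))%N == 0%N)%:R * c k i j.
    have [->|/F1 h] := eqVneq (c k i j) 0; first by rewrite mulr0 if_same.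
    rewrite subn_eq0 eqn_leq h/=; case: leqP => _; by rewrite ?mul1r ?mul0r.
  by apply: cvgM; [exact: cvg_expn0|exact: cvg_cst].
(* w_k - 1 = (w_k - w_i - w_j) + (w_i - 1) + (w_j - 1) + 1, so one factor e is left over. In [trE]
   two such factors give e^-2 = s, which turns the derivative of G_kl into ['X] times it. *)
have cnE n k : e n *: (E n *m cn n k *m E n) = e n ^+ (w k).-1 *: c k.
  apply/matrixP => i j; rewrite mxE EAE !mxE.
  have [->|/F1 h] := eqVneq (c k i j) 0; first by rewrite !(mulr0, mul0r).
  have wE : (w k).-1 = ((w k - (w i + w j)) + (w i).-1 + (w j).-1).+1.
    have := w0 i; have := w0 j; move: h; case: (w i) => // x; case: (w j) => // y h _ _.
    by rewrite /= -[in LHS](subnK h) !addnS !addSn addnA.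
  by rewrite wE exprS !exprD; ring.
have trE n k l : \tr (cn n k *m (U n *m (U n)^T) *m (cn n l)^T *m (U n *m (U n)^T)) =
    e n ^+ (w k).-1 * ('X * deriv (GG k l)).[(e n)^-1 ^+ 2] * e n ^+ (w l).-1.
  set G := g (t n) *m (g (t n))^T.
  have -> : \tr (cn n k *m (U n *m (U n)^T) *m (cn n l)^T *m (U n *m (U n)^T)) =
      \tr ((E n *m cn n k *m E n) *m G *m (E n *m cn n l *m E n)^T *m G).
    rewrite !gramE -/G !trmx_mul tr_diag_mx.
    by rewrite -!mulmxA [RHS]mxtrace_mulC -!mulmxA.
  have eZ x : E n *m cn n x *m E n = (e n)^-1 *: (e n ^+ (w x).-1 *: c x).
    by rewrite -cnE scalerA mulVf// scale1r.
  rewrite !eZ !linearZ/= -!(scalemxAl, scalemxAr) !linearZ/=.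
  rewrite hornerM hornerX se dGG.
  have -> : (quadf c GG k l).[s (t n)] = \tr (c k *m G *m (c l)^T *m G).
    rewrite -quadf_trace; do 2![rewrite horner_sum; apply: eq_bigr => ? _].
    do 2![rewrite horner_sum; apply: eq_bigr => ? _].
    by rewrite hornerZ hornerM -!hG.
  by rewrite -se; field.
have cgw i j k : cg k i j != 0 -> (w i + w j = w k)%N.
  by rewrite mxE; case: (eqVneq (w i + w j)%N (w k)) => // _ /eqP.
(* Two computations of the same limit are compared. The operator s d/ds multiplies the coefficient
   of degree w_k - 1 by w_k - 1. *)
have Lc k l : \tr (cg k *m L *m (cg l)^T *m L) = (w k).-1%:R * L k l.
  have h1 := mcvg_trace (mcvgM (mcvgM (mcvgM (cn_cvg k) gram_cvg) (mcvg_tr (cn_cvg l))) gram_cvg).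
  have h2 : \tr (cn n k *m (U n *m (U n)^T) *m (cn n l)^T *m (U n *m (U n)^T)) @[n --> \oo]
      --> (if w k == w l then ('X * deriv (GG k l))`_(w k).-1 else 0).
    under eq_fun do rewrite trE.
    apply: poly_scaled_cvg => //; apply: leq_trans (size_polyMleq _ _) _.
    rewrite size_polyX addSn add1n/=; have [->|nz] := eqVneq (deriv (GG k l)) 0.
      by rewrite size_poly0 leq_min !w0.
    have gz : GG k l != 0 by apply: contraNneq nz => ->; rewrite deriv0.
    exact: leq_trans (lt_size_deriv gz) (sGG k l).
  rewrite (cvg_uniq h1 h2) mxE; case: eqP => _; last by rewrite mulr0.
  rewrite coefXM; have := w0 k; case: (w k) => // -[|x] _ /=; first by rewrite mul0r.
  by rewrite coef_deriv mulr_natl.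
have [BU hBU] : exists B : R, forall n k l, `|U n k l| <= B.
  have /choice[B hB] : forall k, exists B : R, forall n, `|(U n *m (U n)^T) k k| <= B.
    by move=> k; apply: cvg_bounded (gram_cvg k k).
  exists (1 + \sum_k `|B k|) => n k l; apply: norm_le1D.
  apply: le_trans (gram_entry_sqr _ _ _) _; apply: le_trans (ler_norm _) _.
  apply: le_trans (hB _ _) _; apply: le_trans (ler_norm _) _.
  by rewrite (bigD1 k)//= lerDl; apply: sumr_ge0.
have hBm n i j k : `|m (t n) i j k| <= 1.
  have H (x y : 'I_N) : (x < y)%N -> `|m (t n) x y k| <= 1.
    by move=> xy; apply: sqr_le1_norm; rewrite -(m1 _ (tp n)); apply: bdot_entry.
  have [/H//|ji|/val_inj <-] := ltngtP i j.
    by rewrite (sk _ (tp n)) normrN H.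
  have -> : m (t n) i i k = 0 by have := sk _ (tp n) i i k; lra.
  by rewrite normr0.
pose f (x : ('I_N * 'I_N * 'I_N) + ('I_N * 'I_N)) n : R :=
  match x with inl y => m (t n) y.1.1 y.1.2 y.2 | inr y => U n y.1 y.2 end.
have [|phi [iphi [lm hlm]]] := @bolzano_weierstrass_family R _ f (Num.max 1 BU).
  by case=> x n /=; rewrite le_max ?hBm ?hBU ?orbT.
pose nu : bracket R N := fun i j k => lm (inl (i, j, k)).
pose V : 'M[R]_N := \matrix_(k, l) lm (inr (k, l)).
have nu_cvg i j k : m (t (phi n)) i j k @[n --> \oo] --> nu i j k := hlm (inl (i, j, k)).
have V_cvg : mcvg (fun n => U (phi n)) V by move=> k l; rewrite mxE; exact: (hlm (inr (k, l))).
have sub_cvg x y (F : nat -> 'M[R]_(x, y)) A : mcvg F A -> mcvg (fun n => F (phi n)) A.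
  by move=> hF i j; apply: (cvg_subseq iphi (hF i j)).
have VL : V *m V^T = L.
  apply/matrixP => k l; apply: (cvg_uniq (u := fun n => (U (phi n) *m (U (phi n))^T) k l)).
    exact: (mcvgM V_cvg (mcvg_tr V_cvg)).
  exact: (sub_cvg _ _ _ _ gram_cvg).
have uV : V \in unitmx.
  apply: mx_free_unit; apply: (@graded_gram_free _ _ cg w V L) => //.
  - by move=> i j /negbTE wij; rewrite mxE wij.
  - move=> k xi k1 sxi hxi; apply: (F2 k) => // i j wij.
    rewrite -[RHS](hxi i j); apply: eq_bigr => a _.
    have [->|/sxi wa] := eqVneq (xi 0 a) 0; first by rewrite !mul0r.
    by rewrite mxE wij wa eqxx.
  (* Between indices of weight 1 the entries of [L] are those of the Gram matrix of the invertible
     [g 0], so this block is definite. *)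
  - move=> xi sxi xV.
    have : xi *m g 0 = 0.
      apply: row_sqr_eq0; transitivity (xi *m L *m xi^T); last first.
        by rewrite -VL mulmxA xV !mul0mx.
      apply/matrixP => x y; rewrite !ord1 [LHS]mxE [RHS]mxE; apply: eq_bigr => l _.
      rewrite [xi^T l 0]mxE; have [->|/sxi wl] := eqVneq (xi 0 l) 0; first by rewrite !mulr0.
      congr (_ * _); rewrite [LHS]mxE [RHS]mxE; apply: eq_bigr => k _.
      have [->|/sxi wk] := eqVneq (xi 0 k) 0; first by rewrite !mul0r.
      by congr (_ * _); rewrite [RHS]mxE wk wl eqxx -GG0 horner_coef0.
    by move=> /(congr1 (mulmx^~ (invmx (g 0)))); rewrite mulmxK// mul0mx.
have N_eq n k : \sum_a U n k a *: bmx (m (t n)) a =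
    (q (t n) * e n) *: ((U n)^T *m cn n k *m U n).
  have -> : \sum_a U n k a *: bmx (m (t n)) a =
      e n ^+ (w k).-1 *: \sum_a g (t n) k a *: bmx (m (t n)) a.
    by rewrite scaler_sumr; apply: eq_bigr => a _; rewrite mxE scalerA.
  rewrite Nk// [LHS]scalerA [_ * q _]mulrC -[LHS]scalerA.
  have -> : e n ^+ (w k).-1 *: ((g (t n))^T *m c k *m g (t n)) =
      (g (t n))^T *m (e n *: (E n *m cn n k *m E n)) *m g (t n).
    by rewrite cnE -scalemxAr -scalemxAl.
  by rewrite UE trmx_mul tr_diag_mx -scalemxAr -scalemxAl !scalerA !mulmxA.
pose x k := fun n => \sum_a U (phi n) k a *: bmx (m (t (phi n))) a.
pose y k := fun n => (U (phi n))^T *m cn (phi n) k *m U (phi n).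
have x_cvg k : mcvg (x k) (\sum_a V k a *: bmx nu a).
  apply: mcvg_comb => a; first exact: V_cvg.
  move=> i j; have -> : (fun n => bmx (m (t (phi n))) a i j) = (fun n => m (t (phi n)) i j a).
    by apply/funext => n; rewrite mxE.
  by rewrite mxE; apply: nu_cvg.
have y_cvg k : mcvg (y k) (V^T *m cg k *m V).
  exact: (mcvgM (mcvgM (mcvg_tr V_cvg) (sub_cvg _ _ _ _ (cn_cvg k))) V_cvg).
(* An entry to divide by. If the graded bracket vanished, [Lc] would give L_aa = 0 for some a of
   weight above 1, against invertibility of [V]. *)
have [k [i [j ykij]]] : exists k i j, (V^T *m cg k *m V) i j != 0.
  apply: contrapT => hn.
  have cg0 k : cg k = 0.
    have : V^T *m cg k *m V = 0.
      apply/matrixP => i j; rewrite [RHS]mxE; apply/eqP; apply: contrapT => /negP h.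
      by apply: hn; exists k, i, j.
    move=> /(congr1 (fun A => invmx V^T *m A *m invmx V)).
    by rewrite /= mulmx0 mul0mx !mulmxA mulVmx ?unitmx_tr// mul1mx mulmxK.
  have [a wa] : exists a, (1 < w a)%N.
    have /eqP := ck0; have : exists i j, c k0 i j != 0.
      apply: contrapT => h; move/eqP: ck0; apply; apply/matrixP => i j; rewrite [RHS]mxE.
      by apply/eqP; apply: contrapT => /negP cij; apply: h; exists i, j.
    move=> [i [j /F1 h]] _; exists k0; apply: leq_trans h.
    by rewrite -[1%N.+1]/(1 + 1)%N leq_add.
  have /eqP := Lc a a; rewrite cg0 !mul0mx mxtrace0 eq_sym mulf_eq0 pnatr_eq0.
  have /negbTE -> /= : (w a).-1 != 0%N by case: (w a) wa => // -[].
  move=> /eqP Laa.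
  have : (delta_mx 0 a : 'rV[R]_N) *m V = 0.
    apply: row_sqr_eq0; rewrite VL -rowE; apply/matrixP => u v; rewrite !ord1 [RHS]mxE.
    rewrite mxE (bigD1 a)//= big1 ?addr0 => [|b ba].
      by rewrite mxE Laa mul0r.
    by rewrite [X in _ * X]mxE [X in _ * X]mxE (negbTE ba) andbF mulr0.
  move=> /(congr1 (mulmx^~ (invmx V))); rewrite mulmxK// mul0mx => /rowP/(_ a).
  by rewrite !mxE !eqxx => /eqP; rewrite oner_eq0.
pose kn n := q (t (phi n)) * e (phi n).
have xyE n k' i' j' : x k' n i' j' = kn n * y k' n i' j'.
  by rewrite /x N_eq mxE.
(* The size of q is never estimated: the limit of q e is the quotient of two convergent entries. *)
pose kappa := (\sum_a V k a *: bmx nu a) i j / (V^T *m cg k *m V) i j.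
have kn_cvg : kn n @[n --> \oo] --> kappa.
  have h : x k n i j / y k n i j @[n --> \oo] --> kappa.
    by apply: cvgM; [exact: x_cvg|apply: cvgV => //; exact: y_cvg].
  apply: cvg_trans h; apply: near_eq_cvg.
  have yn : \forall n \near \oo, y k n i j != 0.
    by apply: cvgr_neq0 ykij; exact: y_cvg.
  by near=> n; rewrite xyE mulfK//; near: n.
exists (fun n => t (phi n)); split.
- by move=> l; apply: tp.
- by move=> l; rewrite ltrD2l ltr_nat.
- apply/cvgryPge => A; near=> n.
  have phin : (n <= phi n)%N by elim: (n) => // z ih; apply: leq_ltn_trans ih (iphi z).
  apply: (@le_trans _ _ n%:R); first by near: n; exact: nbhs_infty_ger.
  by rewrite /t -[leLHS]add0r lerD// ler_nat.
- have nu1 : bdot nu nu = 1.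
    apply: (cvg_uniq (u := fun n => bdot (m (t (phi n))) (m (t (phi n))))).
      do 3![apply: cvg_bigsum => ? _]; by apply: cvgM; apply: nu_cvg.
    under eq_fun do rewrite m1//.
    exact: cvg_cst.
  exists nu; split=> //.
    move=> nu0; move/eqP: nu1; rewrite nu0 /bdot big1 ?[0 == 1]eq_sym ?oner_eq0// => a _.
    by do 2![apply: big1 => ? _]; rewrite mulr0.
  apply: (@graded_fixed_point _ _ cg w V L kappa nu) => //.
    move=> a b z; apply: (cvg_uniq (u := fun n => m (t (phi n)) a b z)) => //.
    have -> : (fun n => m (t (phi n)) a b z) = (fun n => - m (t (phi n)) b a z).
      by apply/funext => n; rewrite sk.
    by apply: cvgN; apply: nu_cvg.
  move=> k'; apply/matrixP => i' j'.
  apply: (cvg_uniq (u := fun n => x k' n i' j')); first exact: x_cvg.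
  rewrite mxE; have -> : (fun n => x k' n i' j') = (fun n => kn n * y k' n i' j').
    by apply/funext => n; rewrite xyE.
  by apply: cvgM => //; exact: y_cvg.
Unshelve. all: by end_near. Qed.

(** * The given solution as a flow on the half-line, and the conclusion *)

Lemma flow_extension (R : realType) (N : nat) (mut : R -> bracket R N) :
  (forall i j k, mut s i j k @[s --> 0^'+] --> mut 0 i j k) ->
  (forall t : R, 0 < t -> forall i j k,
      is_derive t 1 (fun s => mut s i j k) (flow_rhs (mut t) i j k)) ->
  let m t := mut (Num.max t 0) in
  forall i j k, hderive (fun t => m t i j k) (fun t => flow_rhs (m t) i j k).
Proof.
move=> mut0 hmut m i j k.
have hm (t : R) : 0 < t -> is_derive t 1 (fun t => m t i j k) (flow_rhs (m t) i j k).
  move=> t0; have -> : m t = mut t by rewrite /m max_l// ltW.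
  apply: near_eq_is_derive (hmut t t0 i j k).
  by near=> s; rewrite /m max_l// ltW//; near: s; exact: lt_nbhsr.
split=> // t; rewrite le_eqVlt => /predU1P[<-|t0]; last first.
  apply: differentiable_continuous; apply/derivable1_diffP.
  exact: (@ex_derive _ _ _ _ _ _ _ (hm t t0)).
(* At 0 only right-continuity is known; for s <= 0 the extension is frozen at its initial value and
   the difference vanishes. *)
apply/cvgrPdist_le => e e0; rewrite /m maxxx.
have /cvgrPdist_le/(_ e e0) := mut0 i j k.
rewrite near_withinE => h; near=> s.
have [s0|s0] := ltP 0 s; last by rewrite subrr normr0 ltW.
by move: s0; near: s.
Unshelve. all: by end_near. Qed.

Unset Implicit Arguments.

Theorem theorem3p14 (R : realType) (n : nat) (J : 'M[R]_(2 * n))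
    (mu : bracket R (2 * n)) (mut : R -> bracket R (2 * n)) :
  J *m J = - 1%:M ->
  J^T *m J = 1%:M ->
  in_C J mu ->
  nilpotent mu ->
  mu <> @bzero R (2 * n)%N ->
  mut 0 = bscale (bnorm mu)^-1 mu ->
  (forall i j k, mut s i j k @[s --> 0^'+] --> mut 0 i j k) ->
  (forall t : R, 0 < t -> forall i j k,
      is_derive t 1 (fun s => mut s i j k) (flow_rhs (mut t) i j k)) ->
  exists tl : nat -> R,
    [/\ (forall l, tl l < tl l.+1),
        tl @ \oo --> +oo &
        exists nu : bracket R (2 * n),
          [/\ nu <> @bzero R (2 * n)%N,
              flow_rhs nu = @bzero R (2 * n)%N &
              forall i j k, mut (tl l) i j k @[l --> \oo] --> nu i j k]].
Proof.
move=> _ _ [sk ja _] ni mu0 m0 mut0 hmut.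
pose m t := mut (Num.max t 0).
have hm : forall i j k, hderive (fun t => m t i j k) (fun t => flow_rhs (m t) i j k).
  exact: flow_extension.
have mE t : 0 <= t -> m t = mut t by move=> t0; rewrite /m max_l.
have mu_pos : 0 < bdot mu mu.
  rewrite lt_neqAle eq_sym; apply/andP; split; last first.
    by do 3![apply: sumr_ge0 => ? _]; rewrite -expr2 sqr_ge0.
  apply/negP => /eqP b0; apply: mu0; apply/funext => i; apply/funext => j; apply/funext => k.
  have H (x y : 'I_(2 * n)) : (x < y)%N -> mu x y k = 0.
    move=> xy; have := @bdot_entry _ _ mu x y k xy; rewrite b0 => h.
    by apply/eqP; rewrite -sqrf_eq0 eq_le h sqr_ge0.
  rewrite /bzero; have [/H//|ji|/val_inj <-] := ltngtP i j.
    by rewrite sk H// oppr0.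
  by have := sk i i k; lra.
pose r := (bnorm mu)^-1.
have r0 : 0 < r by rewrite invr_gt0 sqrtr_gt0.
have m0E : m 0 = bscale r mu by rewrite mE.
have m1 : bdot (m 0) (m 0) = 1.
  have -> : bdot (m 0) (m 0) = r ^+ 2 * bdot mu mu.
    rewrite m0E /bdot mulr_sumr; apply: eq_bigr => i _; rewrite mulr_sumr.
    apply: eq_bigr => j _; rewrite mulr_sumr; apply: eq_bigr => k _.
    by rewrite /bscale; ring.
  by rewrite /r exprVn /bnorm sqr_sqrtr ?ltW// mulVf// gt_eqF.
have [g0 [h0 [w [gh0 w0 F1 F2]]]] := adapted_basis sk ja ni.
have [g [h [q [g00 hg hh cq H]]]] := flow_gauge hm r0 m0E m1 sk gh0.
pose c := push g0 h0 mu.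
have gh t : 0 <= t -> g t *m h t = 1%:M by move=> /H[].
have q0 t : 0 <= t -> 0 < q t by move=> /H[].
have skm t : 0 <= t -> Defs.skew (m t) by move=> /H[].
have Nk t : 0 <= t -> forall k, \sum_a g t k a *: bmx (m t) a =
    q t *: ((g t)^T *m c k *m g t) by move=> /H[].
have mt1 := flow_bdot1 hm m1.
have [GG [GG0 dGG sGG]] := @poly_flow _ _ c w (g 0 *m (g 0)^T) w0 F1.
pose s := prim (fun t => q t ^+ 2).
have hs : hderive s (fun t => q t ^+ 2).
  by apply: hderive_prim; apply: hcontM.
have s0 : s 0 = 0 by rewrite /s prim0.
have hG := @poly_flow_eval _ _ c w (fun t => g t *m (g t)^T) GG s _ w0 F1 GG0 dGG s0 hs
  (gram_flow hg skm Nk).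
have sun := rescaled_time_unbounded hh mt1 gh q0 Nk s0 hs hG.
have smono t u : 0 <= t -> t <= u -> s t <= s u.
  by move=> t0 tu; apply: (hderive_mono hs) => // v _ _; exact: sqr_ge0.
(* If every [c k] vanished, inverting the frame at time 0 would give m(0) = 0, against unit norm. *)
have ck : exists k, c k != 0.
  apply: contrapT => hc; move: (mt1 0 (lexx 0)) => /eqP; rewrite /bdot big1 ?[0 == 1]eq_sym ?oner_eq0//.
  have hg0 : h0 *m g0 = 1%:M by exact: mulmx1C.
  have N0 k : \sum_a g 0 k a *: bmx (m 0) a = 0.
    have c0 : c k = 0 by apply/eqP; apply: contrapT => /negP ck; apply: hc; exists k.
    by rewrite Nk// c0 mulmx0 mul0mx scaler0.
  have B0 a : bmx (m 0) a = 0.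
    rewrite -[LHS](@sum_scale_invK _ _ _ _ g0 h0 (bmx (m 0)) a hg0).
    by rewrite big1// => k _; rewrite -g00 N0 scaler0.
  move=> i _; apply: big1 => j _; apply: big1 => a _.
  by have /matrixP/(_ i j) := B0 a; rewrite !mxE => ->; rewrite mul0r.
have ug : g 0 \in unitmx.
  by have /mulmx1_unit[] := gh 0 (lexx 0).
have [tl [tlp tlS tloo [nu [nu0 fnu lnu]]]] :=
  rescaled_limit w0 F1 F2 ck ug mt1 skm Nk GG0 dGG sGG hG smono sun.
exists tl; split=> //; exists nu; split=> // i j k.
have -> : (fun l => mut (tl l) i j k) = (fun l => m (tl l) i j k).
  by apply/funext => l; rewrite mE.
exact: lnu.
Qed.
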